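(* Let $\Delta$ be an upward equilateral triangle of side length $n$ divided into $n^2$ unit triangles, and let $S$ be an arrangement of triangular holes in $\Delta$. Then any two rhombus tilings of $\Delta\setminus\bigcup_{s\in S}s$ are connected by a (possibly empty) finite sequence of GD flips and inverses of GD flips, every intermediate configuration being a rhombus tiling of $\Delta\setminus\bigcup_{s\in S}s$.
   Context: All triangles are equilateral and grid-aligned; ''upward'' means having the same orientation as $\Delta$, which has a horizontal bottom side. An arrangement of triangular holes is a set $S$ of upward triangles in $\Delta$ with pairwise disjoint interiors and side lengths summing to $n$ (the basic case being $n$ unit triangles). A rhombus is the union of two unit grid triangles sharing an edge; a rhombus tiling of a region is a partition (up to boundaries) of its unit triangles into rhombi. A rhombus is vertical if it has no horizontal edges. GD: for an integer $m\ge 0$, take an upward grid-aligned triangle $T$ of side $m+3$, remove its three corner unit triangles, and remove the upward triangle of side $m$ in the middle of $T$ (at distance one grid row from each side of $T$; nothing is removed in the middle if $m=0$). The remaining region has exactly two rhombus tilings. The clockwise GD (CW-GD) of size $m$ is the one in which the vertical rhombi go along the left side of $T$; the counter-clockwise GD (CCW-GD) of size $m$ is the other one. A GD flip, applied to a tiling whose rhombi include all the rhombi of a CW-GD, replaces these rhombi with those of the CCW-GD on the same region, leaving everything else unchanged (the corner unit triangles and the middle triangle of $T$ may be covered in any way). *)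

(* Defs.v *)
From mathcomp Require Import all_boot.

Set Implicit Arguments.
Unset Strict Implicit.
Unset Printing Implicit Defensive.

(* Lattice points are written (x, y) in the oblique basis e1 = (1, 0),
   e2 = (1/2, sqrt 3 / 2): the grid lines are x = const, y = const (the
   horizontal ones) and x + y = const.  The big triangle of side n has vertices
   (0, 0), (n, 0) and (0, n), so that its left side lies on x = 0 and its bottom
   side on y = 0. *)
Definition point := (nat * nat)%type.

(* (true, (i, j)) is the upward unit triangle with vertices
   (i, j), (i + 1, j), (i, j + 1); (false, (i, j)) is the downward unit triangle
   with vertices (i + 1, j), (i, j + 1), (i + 1, j + 1).  The type also contains
   unit triangles lying outside the big triangle; see [Delta]. *)
Definition cell (n : nat) := (bool * ('I_n * 'I_n))%type.

(* The endpoints of an edge are always listed in the same order, so that equal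
   edges are equal as pairs. *)
Definition edges (n : nat) (c : cell n) : seq (point * point) :=
  let: (up, (i, j)) := c in
  if up then [:: ((i : nat, j : nat), (i.+1, j : nat));
                 ((i : nat, j : nat), (i : nat, j.+1));
                 ((i.+1, j : nat), (i : nat, j.+1))]
  else [:: ((i : nat, j.+1), (i.+1, j.+1));
           ((i.+1, j : nat), (i.+1, j.+1));
           ((i.+1, j : nat), (i : nat, j.+1))].

Definition share_edge (n : nat) (c d : cell n) : bool :=
  has (fun e => e \in edges d) (edges c).

Definition horizontal (e : point * point) : bool := e.1.2 == e.2.2.

(* The unit triangles of the upward triangle of side k with vertices
   (a, b), (a + k, b), (a, b + k).  This is the whole triangle as soon as
   a + b + k <= n, and it is empty for k = 0. *)
Definition triangle (n a b k : nat) : {set cell n} :=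
  [set c : cell n | let: (up, (i, j)) := c in
     [&& a <= i, b <= j & (if up then i + j else (i + j).+1) < a + b + k]].

Definition Delta (n : nat) : {set cell n} := triangle n 0 0 n.

Definition rhombus (n : nat) (B : {set cell n}) : bool :=
  [exists c, exists d, [&& c != d, share_edge c d & B == [set c; d]]].

(* The edges of a rhombus are those of its two triangles, except the one they
   share. *)
Definition rhombus_edge (n : nat) (B : {set cell n}) (e : point * point) : bool :=
  #|[set c in B | e \in edges c]| == 1.

Definition vertical (n : nat) (B : {set cell n}) : Prop :=
  rhombus B /\ forall e, rhombus_edge B e -> ~~ horizontal e.

Definition tiling (n : nat) (D : {set cell n}) (P : {set {set cell n}}) : bool :=
  partition P D && [forall B in P, rhombus B].

(* A hole (a, b, k) stands for [triangle n a b k]. *)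
Definition hole (n : nat) := ('I_n * 'I_n * 'I_n.+1)%type.

Definition side (n : nat) (s : hole n) : nat := s.2.

Definition hole_cells (n : nat) (s : hole n) : {set cell n} :=
  triangle n s.1.1 s.1.2 s.2.

Definition arrangement (n : nat) (S : {set hole n}) : Prop :=
  [/\ forall s, s \in S -> 0 < side s /\ s.1.1 + s.1.2 + side s <= n,
      forall s t, s \in S -> t \in S -> s != t ->
        [disjoint hole_cells s & hole_cells t]
    & \sum_(s in S) side s = n].

Definition holed_region (n : nat) (S : {set hole n}) : {set cell n} :=
  Delta n :\: \bigcup_(s in S) hole_cells s.

(* Here T is the upward triangle of side m + 3 with lower left vertex (a, b). *)
Definition GD_region (n a b m : nat) : {set cell n} :=
  triangle n a b (m + 3)
    :\: (triangle n a b 1 :|: triangle n (a + m + 2) b 1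
           :|: triangle n a (b + m + 2) 1 :|: triangle n a.+1 b.+1 m).

(* The left side of T lies on x = a. *)
Definition along_left (n a : nat) (B : {set cell n}) : Prop :=
  exists e, [/\ rhombus_edge B e, e.1.1 = a & e.2.1 = a].

Definition CW_GD (n a b m : nat) (G : {set {set cell n}}) : Prop :=
  tiling (GD_region n a b m) G /\
  forall B, B \in G -> vertical B -> along_left a B.

(* The region has exactly two tilings, so this singles out the other one. *)
Definition CCW_GD (n a b m : nat) (G : {set {set cell n}}) : Prop :=
  tiling (GD_region n a b m) G /\ ~ CW_GD a b m G.

(* T is required to lie in the big triangle.  This is no restriction for tilings
   of subregions of [Delta n]: the rhombi of a GD reach all three sides of T. *)
Definition GD_flip (n : nat) (P Q : {set {set cell n}}) : Prop :=
  exists a b m (G H : {set {set cell n}}),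
    [/\ a + b + (m + 3) <= n, CW_GD a b m G, CCW_GD a b m H,
        G \subset P & Q = (P :\: G) :|: H].

(* Main.v *)
Require Import Defs.
From mathcomp Require Import all_boot all_algebra zify.
From Stdlib Require Import Classical.

Set Implicit Arguments.
Unset Strict Implicit.
Unset Printing Implicit Defensive.

                                                                               
                                                                                 
                                                                                
                                                                                 
                                                                                 
                                                                             
                                                                                 
                                                

                                                                                
                                                                                 
                                                                                          
                                                                            
                                                                             
                                                                                  
                                                                           
                                                                                
                                                                              
                                                    

                                                 

                                                                             
                                                                                
                        
(** A tiling is a matching of downward triangles with adjacent upward ones. Filling the holes with
    vertical pairs makes it a matching of all downward triangles of [Delta n], whose set of matched
    upward triangles depends on [S] alone ([tiling_configP]). Direct every grid edge with its
    downward triangle on the right, and call it passable if no matched pair lies across it. A CW-GD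
    is then a triangle of lattice points, possibly a single point, that no passable edge enters from
    outside ([closed_tri]).

    A GD flip moves vertical rhombi to the right ([flip_potential]), so every tiling is led by flips
    to one without CW-GD ([flip_to_terminal]). It remains to see that this terminal tiling is unique
    ([terminal_uniq]). If two configurations differ, their height functions differ, and one exceeds
    the other somewhere. Along a passable edge of the higher one the excess cannot increase, so the
    points of maximal excess are closed under predecessors; they are interior, since the excess
    vanishes on the boundary ([height_lt_closed]). They therefore contain a strongly connected
    component [Z] that no passable edge enters.

    Such a [Z] yields a closed triangle ([closed_tri_component]). A closed walk in [Z] has
    nonnegative winding numbers ([winding_ge0]), so every passable edge of [Z] borders a region of
    upward triangles enclosed by edges of [Z]. The union of these regions contains the third upward
    neighbour of a downward triangle as soon as it contains two ([third]), so a full triangle in it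
    grows whenever another piece touches it ([full_grow]). A largest full triangle meeting [Z] is
    thus isolated: it contains [Z], its sides lie in [Z], and no passable edge enters it. The higher
    configuration was therefore not terminal. *)

(** * Directed grid edges and source components *)

Definition edge_src (k i j : nat) : point :=
  match k with 0 => (i.+1, j) | 1 => (i, j.+1) | _ => (i.+1, j.+1) end.

(** The edges [k = 0, 1, 2] of the downward triangle [(i, j)], taken from source to target, run
    clockwise around it, so the adjacent upward triangle is always on the left. *)
Definition edge_tgt (k i j : nat) : point :=
  match k with 0 => (i, j.+1) | 1 => (i.+1, j.+1) | _ => (i.+1, j) end.

                                                                     
                           
(** The upward triangle [(up_x k i, up_y k j)] lies across edge [k] of the downward triangle
    [(i, j)]; [k = 1] is the horizontal edge, hence the vertical rhombi. *)
Definition up_x (k i : nat) : nat := i + (k == 2).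

Definition up_y (k j : nat) : nat := j + (k == 1).

                                                                    
(** [c k i j] means that the downward triangle [(i, j)] is matched across its edge [k]. The relation
    is boolean so as to serve [path] and [connect]; the tests [0 < a.2] and [0 < a.1] keep [.-1]
    honest. *)
Definition passable (c : nat -> nat -> nat -> bool) (a b : point) : bool :=
  [|| [&& b.1 == a.1.+1, b.2 == a.2, 0 < a.2 & ~~ c 1 a.1 a.2.-1],
      [&& a.1 == b.1.+1, b.2 == a.2.+1 & ~~ c 0 b.1 a.2]
    | [&& a.1 == b.1, a.2 == b.2.+1, 0 < a.1 & ~~ c 2 a.1.-1 b.2]].

Lemma passableP c a b : passable c a b ->
  exists k i j, [/\ k < 3, a = edge_src k i j, b = edge_tgt k i j & ~~ c k i j].
Proof.
case: a b => [x y] [x' y'] /or3P[] /=.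
- case/and4P=> /eqP-> /eqP-> y0 nc; exists 1, x, y.-1; split=> //=; congr pair; lia.
- by case/and3P=> /eqP-> /eqP-> nc; exists 0, x', y; split.
- case/and4P=> /eqP-> /eqP-> x0 nc; exists 2, x'.-1, y'; split=> //=; congr pair; lia.
Qed.

Lemma passable_edge c k i j : k < 3 -> ~~ c k i j -> passable c (edge_src k i j) (edge_tgt k i j).
Proof.
by case: k => [|[|[|//]]] _ nc; rewrite /passable /= !eqxx ?nc /= ?orbT.
Qed.

(** A vertex of [A] with fewest ancestors will do: each of its ancestors has no further ones and no
    fewer, hence is reached back from it. *)
Lemma source_component (T : finType) (e : rel T) (A : {set T}) (x0 : T) :
  x0 \in A -> (forall u v, e u v -> v \in A -> u \in A) ->
  exists2 v0, v0 \in A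
    & forall u, connect e u v0 -> u \in A /\ connect e v0 u.
Proof.
move=> Ax0 clA; pose pr v := [set u | connect e u v].
have [v0 Av0 min_v0] := @arg_minnP _ x0 (mem A) (fun v => #|pr v|) Ax0.
exists v0 => // u uv0.
have Au : u \in A.
  case/connectP: uv0 Av0 => p; elim: p u => [|y p IHp] u /=; first by move=> _ ->.
  by case/andP=> uy yp lp Av; apply: clA uy _; apply: (IHp y yp lp Av).
split=> //.
have sub : pr u \subset pr v0.
  by apply/subsetP=> x; rewrite !inE => /connect_trans; apply.
have /eqP eqp : pr u == pr v0 by rewrite eqEcard sub; apply: min_v0.
have : v0 \in pr v0 by rewrite inE connect0.
by rewrite -eqp inE.
Qed.

(** * Winding numbers of closed walks *)

Section Walk.
Import GRing.Theory.
Local Open Scope ring_scope.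

Fixpoint walk_sum (f : point -> point -> int) (x : point) (p : seq point) : int :=
  if p is y :: q then f x y + walk_sum f y q else 0.

(** Edge functions that differ by a gradient have equal sums over closed walks. *)
Lemma walk_sum_telescope (e : rel point) f f' (g : point -> int) x p : path e x p ->
  (forall a b, e a b -> f a b - f' a b = g b - g a) ->
  walk_sum f x p - walk_sum f' x p = g (last x p) - g x.
Proof.
move=> + E; elim: p x => [|y p IHp] x /=; first lia.
by case/andP=> xy /IHp; move: (E _ _ xy); lia.
Qed.

Lemma walk_sum_ge0 f x p : (forall a b, 0 <= f a b) -> 0 <= walk_sum f x p.
Proof. move=> f0; elim: p x => //= y p IHp x; have := f0 x y; have := IHp y; lia. Qed.

Lemma walk_sum_neq0 (e : rel point) f x p : path e x p -> walk_sum f x p != 0 ->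
  exists a b, [/\ e a b, f a b != 0, a \in x :: p & b \in x :: p].
Proof.
elim: p x => //= y p IHp x /andP[xy yp].
have [-> |] := eqVneq (f x y) 0.
  rewrite add0r => /(IHp _ yp)[a [b [ab f0 ain bin]]].
  by exists a, b; split; rewrite // inE ?ain ?bin orbT.
by exists x, y; rewrite !inE !eqxx ?orbT.
Qed.

                                                                                  
(** Summed over a closed walk, this is the winding number around the upward triangle [(i, j)]:
    signed crossings of the strip between heights [j] and [j.+1], to the right of that triangle.
    [dn_crossing] does the same for the downward triangle. *)
Definition up_crossing (i j : nat) (a b : point) : int :=
  [&& a.2 == j, b.2 == j.+1 & (i < a.1)%N]%:Z
  - [&& a.2 == j.+1, b.2 == j & (i < b.1)%N]%:Z.

Definition dn_crossing (i j : nat) (a b : point) : int :=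
  [&& a.2 == j, b.2 == j.+1 & (i.+1 < a.1)%N]%:Z
  - [&& a.2 == j.+1, b.2 == j & (i < b.1)%N]%:Z.

Definition traversal (k i j : nat) (a b : point) : int :=
  ((a == edge_src k i j) && (b == edge_tgt k i j))%:Z.

(** Across a horizontal edge ([k = 1]) the two triangles lie in different strips, and their crossing
    counts agree only up to this gradient. *)
Definition edge_potential (k i j : nat) (v : point) : int :=
  - [&& k == 1, v.2 == j.+1 & (i < v.1)%N]%:Z.

                                                                              
                                                                     
Lemma crossing_diff c k i j a b : (k < 3)%N -> passable c a b ->
  up_crossing (up_x k i) (up_y k j) a b - (dn_crossing i j a b + traversal k i j a b)
  = edge_potential k i j b - edge_potential k i j a.
Proof.
move=> k3 /passableP[k' [i' [j' [k'3 -> -> _]]]].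
case: k k3 => [|[|[|//]]] _; case: k' k'3 => [|[|[|//]]] _;
  rewrite /up_x /up_y /up_crossing /dn_crossing /traversal /edge_potential /= ?xpair_eqE; lia.
Qed.


(** [wU] and [wD] are the winding numbers around upward and downward triangles. Upward triangles
    being on the left of edges, [wU] exceeds [wD] across an edge by the number of its traversals. *)
Lemma winding n c (Z : pred point) u v p :
  (forall a, Z a -> [/\ (0 < a.1)%N, (0 < a.2)%N & (a.1 + a.2 < n)%N]) ->
  path (passable c) u (v :: p) -> last v p = u -> all Z (v :: p) ->
  exists wU wD : nat -> nat -> int,
    [/\ forall k i j, (k < 3)%N -> (wD i j <= wU (up_x k i) (up_y k j))%R,
        forall k i j, (k < 3)%N -> (wD i j < wU (up_x k i) (up_y k j))%R ->
          [/\ ~~ c k i j, Z (edge_src k i j) & Z (edge_tgt k i j)],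
        forall k i j, (k < 3)%N -> u = edge_src k i j -> v = edge_tgt k i j ->
          (wD i j < wU (up_x k i) (up_y k j))%R
      & forall i j, wU i j != 0 -> [/\ (0 < i)%N, (0 < j)%N & (i + j + 1 < n)%N]].
Proof.
move=> intZ up lp Zp; pose q := v :: p.
have lq : last u q = u by [].
have Zu : Z u by rewrite -lp; apply: (allP Zp); apply: mem_last.
have Zq a : a \in u :: q -> Z a.
  by rewrite inE => /predU1P[-> //|]; apply: (allP Zp).
have diff k i j : (k < 3)%N -> walk_sum (up_crossing (up_x k i) (up_y k j)) u q
    = walk_sum (dn_crossing i j) u q + walk_sum (traversal k i j) u q.
  move=> k3; have := walk_sum_telescope up (fun a b => @crossing_diff c k i j a b k3).
  rewrite -/q lq; have -> : forall x r,
    walk_sum (fun a b => dn_crossing i j a b + traversal k i j a b) x r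
    = walk_sum (dn_crossing i j) x r + walk_sum (traversal k i j) x r; last lia.
  by move=> x r; elim: r x => //= y r IHr x; rewrite IHr; lia.
have hit_ge0 k i j x r : 0 <= walk_sum (traversal k i j) x r by apply: walk_sum_ge0.
exists (fun i j => walk_sum (up_crossing i j) u q),
  (fun i j => walk_sum (dn_crossing i j) u q); split.
- by move=> k i j k3; rewrite diff //; have := hit_ge0 k i j u q; lia.
- move=> k i j k3; rewrite diff // => lt0.
  have h0 : walk_sum (traversal k i j) u q != 0 by lia.
  have [a [b [ab]]] := walk_sum_neq0 up h0.
  rewrite /traversal; case: andP => // -[/eqP ea /eqP eb] _ /Zq Za /Zq Zb.
  rewrite -ea -eb; split=> //; case/passableP: ab => k' [i' [j' [k'3 ea' eb' nc]]].
  suff [-> -> ->] : [/\ k = k', i = i' & j = j'] by [].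
  move: ea eb; rewrite ea' eb'.
  case: k k3 {lt0 h0} => [|[|[|//]]] _;
    case: k' k'3 {ea' eb' nc} => [|[|[|//]]] _ /= [] ? ? [] ? ?; split; lia.
- move=> k i j k3 eu ev; rewrite diff // /q /= {1}/traversal eu ev !eqxx /=.
  by have := hit_ge0 k i j v p; rewrite -ev; lia.
- move=> i j w0; have [a [b [ab f0 /Zq/intZ[a1 a2 an] /Zq/intZ[b1 b2 bn]]]] := walk_sum_neq0 up w0.
  have j0 : (0 < j)%N by move: f0; rewrite /up_crossing; lia.
  have ijn : (i + j + 1 < n)%N.
    by move: f0; rewrite /up_crossing; lia.
  split=> //; rewrite lt0n; apply: contra_neq w0 => ->.
  pose e a b := [&& passable c a b, Z a & Z b].
  have ep : path e u q.
    move: (up) (Zp) Zu; rewrite -/q; elim: (q) (u) => //= y r IHr x /andP[xy yr] /andP[Zy Zr] Zx.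
    by rewrite /e xy Zx Zy IHr.
  (* All points have positive first coordinate, so for [i = 0] every step between heights [j] and
     [j.+1] counts, and the sum is the net change of [g], which is zero. *)
  pose g (v : point) := (j < v.2)%N%:Z.
  have st a' b' : e a' b' -> up_crossing 0 j a' b' - 0 = g b' - g a'.
    case/and3P => /passableP[k' [i' [j' [k'3 -> -> _]]]] /intZ[+ _ _] /intZ[+ _ _].
    by case: k' k'3 => [|[|[|//]]] _; rewrite /up_crossing /g /=; lia.
  have := walk_sum_telescope (f' := fun _ _ => 0) ep st; rewrite lq.
  have -> : walk_sum (fun _ _ => 0) u q = 0; last lia.
  by elim: (q) (u) => //= y r IHr x; rewrite IHr.
Qed.

End Walk.

                                        

(** * Configurations, and the sign of winding numbers *)

Definition below (c : nat -> nat -> nat -> bool) (i j : nat) : bool :=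
  if j is j'.+1 then c 1 i j' else false.

Definition beside (c : nat -> nat -> nat -> bool) (i j : nat) : bool :=
  if i is i'.+1 then c 2 i' j else false.

                                             
(** A matching of all downward triangles of [Delta n] with the upward triangles in [occ]. *)
Record config (n : nat) (occ : nat -> nat -> bool) (c : nat -> nat -> nat -> bool)
    : Prop := Config {
  config_dn : forall i j, c 0 i j + c 1 i j + c 2 i j = (i + j + 2 <= n);
  config_up : forall i j, c 0 i j + below c i j + beside c i j = occ i j }.

Section Matching.

Variables (n : nat) (occ : nat -> nat -> bool) (c : nat -> nat -> nat -> bool).
Hypothesis cfg : config n occ c.

Lemma config_inj k i j k' i' j' : k < 3 -> k' < 3 -> c k i j -> c k' i' j' ->
  up_x k i = up_x k' i' -> up_y k j = up_y k' j' ->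
  [/\ k = k', i = i' & j = j'].
Proof.
have bit (b : bool) : b <= 1 by case: b.
have le1 i0 j0 := bit (occ i0 j0).
have x01 i0 j0 : c 0 i0 j0.+1 -> c 1 i0 j0 -> False.
  by move=> h0 h1; have := le1 i0 j0.+1; rewrite -(config_up cfg) /below h0 h1.
have x02 i0 j0 : c 0 i0.+1 j0 -> c 2 i0 j0 -> False.
  by move=> h0 h1; have := le1 i0.+1 j0; rewrite -(config_up cfg) /beside h0 h1; lia.
have x12 i0 j0 : c 1 i0.+1 j0 -> c 2 i0 j0.+1 -> False.
  move=> h0 h1; have := le1 i0.+1 j0.+1.
  by rewrite -(config_up cfg) /below /beside h0 h1; lia.
move=> k3 k'3.
by case: k k3 => [|[|[|//]]] _; case: k' k'3 => [|[|[|//]]] _ ck ck';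
  rewrite /up_x /up_y /= ?addn0 ?addn1 => ei ej; subst; try (by split; lia);
  exfalso; eauto.
Qed.

Lemma config_ex i j : i + j + 2 <= n -> exists2 k, k < 3 & c k i j.
Proof.
move=> ijn; have := config_dn cfg i j; rewrite ijn.
case c0: (c 0 i j); first by exists 0.
case c1: (c 1 i j); first by exists 1.
by case c2: (c 2 i j) => // _; exists 2.
Qed.

Lemma config_in k i j : k < 3 -> c k i j -> i + j + 2 <= n.
Proof.
move=> k3 ck; have := config_dn cfg i j.
by case: k k3 ck => [|[|[|//]]] _ ck; rewrite ck; lia.
Qed.

                                                                                
                                                                             
                                                                                  
(** Matched triangles have equal winding numbers, so the matching injects negative downward
    triangles into negative upward ones. Conversely a negative upward triangle has, across edge 0, a
    negative downward one with the same coordinates. By counting, both sets have the same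
    coordinates; negativity then travels left across the edges 2 to the border, where [wU]
    vanishes. *)
Lemma winding_ge0 (wU wD : nat -> nat -> int) :
  (forall k i j, k < 3 -> (wD i j <= wU (up_x k i) (up_y k j))%R) ->
  (forall k i j, k < 3 -> (wD i j < wU (up_x k i) (up_y k j))%R ->
     ~~ c k i j) ->
  (forall i j, wU i j != 0%R -> [/\ 0 < i, 0 < j & i + j + 1 < n]) ->
  forall i j, i + j + 2 <= n -> (0 <= wD i j)%R.
Proof.
move=> le_w lt_w w0.
pose Rd := [set p : 'I_n * 'I_n | (p.1 + p.2 + 2 <= n) && (wD p.1 p.2 < 0)%R].
pose Ru := [set p : 'I_n * 'I_n | (wU p.1 p.2 < 0)%R].
have RuRd : Ru \subset Rd.
  apply/subsetP=> -[x y]; rewrite !inE /= => wp.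
  have [|? ? ?] := w0 x y; first by lia.
  have := le_w 0 x y isT; rewrite /up_x /up_y !addn0; lia.
pose mt (p : 'I_n * 'I_n) := if c 0 p.1 p.2 then 0 else if c 1 p.1 p.2 then 1 else 2.
have mt3 (p : 'I_n * 'I_n) : mt p < 3 by rewrite /mt; do 2?case: ifP.
have cmt (p : 'I_n * 'I_n) : p.1 + p.2 + 2 <= n -> c (mt p) p.1 p.2.
  move=> /config_ex[k k3]; rewrite /mt; case: ifP => // n0; case: ifP => // n1.
  by case: k k3 => [|[|[|//]]] _; rewrite ?n0 ?n1.
(* The partner of [p]; for [p] inside the big triangle the defaults of [insubd] do not occur ([f1],
   [f2]). *)
pose f (p : 'I_n * 'I_n) :=
  (insubd p.1 (up_x (mt p) p.1), insubd p.2 (up_y (mt p) p.2)).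
have f1 (p : 'I_n * 'I_n) : p.1 + p.2 + 2 <= n -> (f p).1 = up_x (mt p) p.1 :> nat.
  by move=> pn; rewrite /f /= val_insubd /up_x /up_y; case: ifP => //; lia.
have f2 (p : 'I_n * 'I_n) : p.1 + p.2 + 2 <= n -> (f p).2 = up_y (mt p) p.2 :> nat.
  by move=> pn; rewrite /f /= val_insubd /up_x /up_y; case: ifP => //; lia.
have injf : {in Rd &, injective f}.
  move=> p q; rewrite !inE => /andP[pn _] /andP[qn _] fpq.
  have [] := config_inj (mt3 p) (mt3 q) (cmt _ pn) (cmt _ qn).
  - by rewrite -f1 // -f1 // fpq.
  - by rewrite -f2 // -f2 // fpq.
  by move=> _ /val_inj e1 /val_inj e2; case: p q e1 e2 {pn qn fpq} => [? ?] [? ?] /= -> ->.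
have fRu : f @: Rd \subset Ru.
  apply/subsetP=> _ /imsetP[p + ->]; rewrite !inE => /andP[pn wp].
  have := le_w _ p.1 p.2 (mt3 p); have := lt_w _ p.1 p.2 (mt3 p).
  rewrite cmt // -f1 // -f2 // /=; case: p pn wp => x y /=; lia.
have {fRu injf} RdRu : Rd = Ru.
  by apply/esym/eqP; rewrite eqEcard RuRd -(card_in_imset injf) subset_leq_card.
have desc i j : (wU i j < 0)%R -> i + j + 1 <= n -> False.
  elim: i => [|i IHi] wi ijn; first by have [] := w0 0 j; lia.
  apply: IHi; last lia.
  have := le_w 2 i j isT; rewrite /up_x /up_y addn1 addn0 => wdi.
  have ilt : i < n by lia.
  have jlt : j < n by lia.
  have : (Ordinal ilt, Ordinal jlt) \in Rd by rewrite inE /=; lia.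
  by rewrite RdRu inE.
move=> i j ijn; case: (boolP (0 <= wD i j)%R) => // nw.
have wij : (wD i j < 0)%R by lia.
have ilt : i < n by lia.
have jlt : j < n by lia.
have : (Ordinal ilt, Ordinal jlt) \in Rd by rewrite inE /= ijn.
by rewrite RdRu inE /= => wij'; case: (desc _ _ wij'); lia.
Qed.

End Matching.

                                                     

(** * Growing full triangles *)

Lemma spread (Q : nat -> Prop) lo hi k :
  (forall x, lo <= x < hi -> Q x <-> Q x.+1) -> lo <= k <= hi -> Q k ->
  forall x, lo <= x <= hi -> Q x.
Proof.
move=> st kin Qk x xin.
have up d : k + d <= hi -> Q (k + d).
  elim: d => [|d IHd] dle; first by rewrite addn0.
  have [|f _] := st (k + d); first lia.
  by rewrite addnS; apply: f; apply: IHd; lia.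
have dn d : d <= k - lo -> Q (k - d).
  elim: d => [|d IHd] dle; first by rewrite subn0.
  have [|_ f] := st (k - d.+1); first lia.
  by apply: f; have -> : (k - d.+1).+1 = k - d by [lia]; apply: IHd; lia.
have [kx|xk] := leqP k x; first by rewrite -(subnKC kx); apply: up; lia.
by have -> : x = k - (k - x) by [lia]; apply: dn; lia.
Qed.

                                                                           
                                        
Definition full (U : nat -> nat -> Prop) (a b m : nat) : Prop :=
  forall i j, a <= i -> b <= j -> i + j < a + b + m -> U i j.

Definition in_tri (a b m : nat) (v : point) : bool :=
  [&& a <= v.1, b <= v.2 & v.1 + v.2 <= a + b + m].

(** The new piece lies in the row just outside one of the three sides. Two consecutive upward
    triangles of that row and one of the full triangle surround a downward triangle, so the closure
    hypotheses spread membership along the entire row. *)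
Lemma full_grow (U : nat -> nat -> Prop) a b m i j :
  (forall x y, U x y.+1 -> U x.+1 y -> U x y) ->
  (forall x y, U x y -> U x.+1 y -> U x y.+1) ->
  (forall x y, U x y -> U x y.+1 -> U x.+1 y) ->
  full U a b m -> U i j ->
  [|| in_tri a b m (i, j), in_tri a b m (i.+1, j) | in_tri a b m (i, j.+1)] ->
  ~~ [&& a <= i, b <= j & i + j < a + b + m] ->
  exists a' b', full U a' b' m.+1
    /\ forall v, in_tri a b m v -> in_tri a' b' m.+1 v.
Proof.
move=> r0 r1 r2 fT Uij; rewrite /in_tri /= => touch out.
have [jb|jb] := ltnP j b.
  exists a, j; split; last by move=> v; lia.
  have eb : b = j.+1 by lia.
  have st x : a <= x < a + m -> U x j <-> U x.+1 j.
    by move=> xin; have Ux : U x j.+1 by [apply: fT; lia]; split=> h;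
      [apply: r2|apply: r0].
  have sp := spread st _ Uij.
  move=> x y ax jy xy; have [yb|yb] := ltnP j y; first by apply: fT; lia.
  by have -> : y = j by [lia]; apply: sp; lia.
have [ia|ia] := ltnP i a.
  exists i, b; split; last by move=> v; lia.
  have ea : a = i.+1 by lia.
  have st y : b <= y < b + m -> U i y <-> U i y.+1.
    by move=> yin; have Uy : U i.+1 y by [apply: fT; lia]; split=> h;
      [apply: r1|apply: r0 h _].
  have sp := spread st _ Uij.
  move=> x y ix by_ xy; have [xa|xa] := ltnP i x; first by apply: fT; lia.
  by have -> : x = i by [lia]; apply: sp; lia.
exists a, b; split; last by move=> v; lia.
have eij : i + j = a + b + m by lia.
pose Q x := U x (a + b + m - x).
have st x : a <= x < a + m -> Q x <-> Q x.+1.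
  move=> xin; have Ux : U x (a + b + m - x.+1) by apply: fT; lia.
  rewrite /Q; have -> : a + b + m - x = (a + b + m - x.+1).+1 by lia.
  by split=> h; [apply: r2 Ux h|apply: r1 Ux h].
have Qi : Q i by rewrite /Q; have -> : a + b + m - i = j by lia.
have sp := spread st _ Qi.
move=> x y ax by_ xy; have [lt|ge] := ltnP (x + y) (a + b + m).
  by apply: fT; lia.
by have -> : y = a + b + m - x by [lia]; apply: sp; lia.
Qed.

Lemma max_nat (R : nat -> Prop) N m0 : (forall m, R m -> m <= N) -> R m0 ->
  exists2 m, R m & ~ R m.+1.
Proof.
move=> bR; move: {2}(N - m0) (leqnn (N - m0)) => d; elim: d m0 => [|d IHd] m le_d Rm.
  by exists m => // /bR; lia.
have [/IHd|] := classic (R m.+1); last by exists m.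
by apply; lia.
Qed.

                                                                               
                                                                        
(** * Closed triangles from source components *)

(** These are the pairs of the CW-GD of size [m] with lower left vertex [(a, b)]. Equivalently, no
    passable edge enters from outside the triangle of points with lower left corner [(a + 1, b + 1)]
    and side [m]. *)
Definition closed_tri (c : nat -> nat -> nat -> bool) (a b m : nat) : Prop :=
  forall k, k <= m ->
    [/\ c 1 a (b + k), c 0 (a + 1 + k) b & c 2 (a + k) (b + 1 + m - k)].

Section Component.

Variables (n : nat) (occ : nat -> nat -> bool) (c : nat -> nat -> nat -> bool).
Hypothesis cfg : config n occ c.
Variables (Z : pred point) (v0 : point).
Hypothesis intZ : forall a, Z a -> [/\ 0 < a.1, 0 < a.2 & a.1 + a.2 < n].
Hypothesis backZ : forall a b, passable c a b -> Z b -> Z a.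
Hypothesis walkZ : forall b, Z b -> exists2 p, path (passable c) v0 p & last v0 p = b.
Hypothesis connZ : forall b, Z b -> exists2 p, path (passable c) b p & last b p = v0.
Hypothesis Zv0 : Z v0.

Let edge_ok k i j := [/\ ~~ c k i j, Z (edge_src k i j) & Z (edge_tgt k i j)].

                                                                              
                                                                                
           
(** [Z] is a strongly connected component that no passable edge enters. Completed by the downward
    triangles with all neighbours in [U], a good [U] is a region bounded by passable edges of
    [Z]. *)
Let good (U : nat -> nat -> Prop) :=
  (forall i j, U i j -> [/\ 0 < i, 0 < j & i + j + 2 <= n]) /\
  forall k k' i j, k < 3 -> k' < 3 -> U (up_x k i) (up_y k j) ->
    ~ U (up_x k' i) (up_y k' j) -> edge_ok k i j.

(** Unions of good sets are good, so this is the largest one. *)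
Let Umax i j := exists2 U, good U & U i j.

Let good_Umax : good Umax.
Proof.
split=> [i j [U [bU _] /bU //]|k k' i j k3 k'3 [U gU Uk] nU].
by apply: gU.2 k3 k'3 Uk _ => Uk'; apply: nU; exists U.
Qed.

Let Zpath b p : path (passable c) b p -> Z (last b p) -> all Z (b :: p).
Proof.
elim: p b => [|y p IHp] b /=; first by move=> _ ->.
by case/andP=> by_ yp Zl; have /= /andP[Zy ->] := IHp _ yp Zl; rewrite Zy (backZ by_ Zy).
Qed.

(** The edge lies on a closed walk in [Z], and the upward triangles with [0 < wU] form a good set:
    if one neighbour of a downward triangle is in and another is out, [wD] is at most zero, so the
    edge to the first was traversed. The given edge is traversed and [0 <= wD] there, so its upward
    triangle is in. *)
Let edge_Umax k i j : k < 3 -> ~~ c k i j -> Z (edge_tgt k i j) ->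
  Umax (up_x k i) (up_y k j).
Proof.
move=> k3 nc Zh; have hd := passable_edge k3 nc; have Zt := backZ hd Zh.
have [p1 pp1 lp1] := connZ Zh; have [p2 pp2 lp2] := walkZ Zt.
have pth : path (passable c) (edge_src k i j) (edge_tgt k i j :: p1 ++ p2).
  by rewrite /= hd cat_path pp1 lp1.
have lst : last (edge_tgt k i j) (p1 ++ p2) = edge_src k i j by rewrite last_cat lp1.
have Zall : all Z (edge_tgt k i j :: p1 ++ p2).
  by apply: Zpath; rewrite ?lst //; case/andP: pth.
have [wU [wD [le_w lt_w hit_w w0]]] := winding intZ pth lst Zall.
have lt_n k' i' j' : k' < 3 ->
    (wD i' j' < wU (up_x k' i') (up_y k' j'))%R -> ~~ c k' i' j'.
  by move=> k'3 /(lt_w _ _ _ k'3)[].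
have wD0 : (0 <= wD i j)%R.
  apply: (winding_ge0 cfg le_w lt_n w0).
  have [_ _ ht] := intZ Zt; have [_ _ hh] := intZ Zh.
  by move: ht hh; clear -k3; case: k k3 => [|[|[|//]]] _ /=; lia.
exists (fun i j => (0 < wU i j)%R); last first.
  by have := hit_w k i j k3 erefl erefl; move: wD0; clear; lia.
split=> [i' j' wp|k1 k2 i' j' k13 k23 w1 w2].
  have [|i0 j0 ij] := w0 i' j'; first by move: wp; clear; lia.
  by split=> //; move: ij; clear; lia.
by apply: lt_w => //; have := le_w k2 i' j' k23; move: w1 w2; clear; lia.
Qed.

(** Otherwise edges [k1] and [k2] are passable edges of [Z], so the downward triangle is matched
    across [k3], and the partner can be added to [Umax] without spoiling goodness. *)
Let third k1 k2 k3 i j : k1 < 3 -> k2 < 3 -> k3 < 3 ->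
  k1 != k2 -> k1 != k3 -> k2 != k3 ->
  Umax (up_x k1 i) (up_y k1 j) -> Umax (up_x k2 i) (up_y k2 j) ->
  Umax (up_x k3 i) (up_y k3 j).
Proof.
move=> l1 l2 l3 n12 n13 n23 U1 U2; apply: NNPP => U3.
have [nc1 Zt1 Zh1] := good_Umax.2 _ _ _ _ l1 l3 U1 U3.
have [nc2 Zt2 Zh2] := good_Umax.2 _ _ _ _ l2 l3 U2 U3.
have [Za Zb Zd] : [/\ Z (i.+1, j), Z (i, j.+1) & Z (i.+1, j.+1)].
  move: n12 Zt1 Zh1 Zt2 Zh2; clear -l1 l2.
  by case: k1 l1 => [|[|[|//]]] _; case: k2 l2 => [|[|[|//]]] _ //=.
have [/= i0 _ _] := intZ Zb; have [/= _ j0 _] := intZ Za.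
have [/= _ _ ijn] := intZ Zd.
have c3 : c k3 i j.
  have [|k kl ck] := config_ex cfg (i := i) (j := j); first by move: ijn; clear; lia.
  have nk1 : k != k1 by apply: contraNneq nc1 => <-.
  have nk2 : k != k2 by apply: contraNneq nc2 => <-.
  by have <- : k = k3 by move: nk1 nk2 kl l1 l2 l3 n12 n13 n23; clear; lia.
pose X := up_x k3 i; pose Y := up_y k3 j.
have free k i' j' : k < 3 -> k != k3 -> up_x k i' = X -> up_y k j' = Y -> ~~ c k i' j'.
  move=> kl nk ex ey; apply/negP => ck.
  by have [ek _ _] := config_inj cfg kl l3 ck c3 ex ey; rewrite ek eqxx in nk.
have [X0 Y0 XY] : [/\ 0 < X, 0 < Y & X + Y + 2 <= n].
  by rewrite /X /Y /up_x /up_y; move: i0 j0 ijn l3; clear; split; lia.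
(* Two vertices of the partner are already in [Z]. Its remaining edges are passable by [free], and
   one of them leads from the third vertex to [Z]. *)
have [Z1 Z2 Z3] : [/\ Z (X, Y), Z (X.+1, Y) & Z (X, Y.+1)].
  move: X0 Y0 XY free; rewrite /X /Y; clear -l3 i0 j0 Za Zb Zd backZ.
  case: k3 l3 => [|[|[|//]]] _; rewrite /up_x /up_y /= ?addn0 ?addn1 => _ _ _ free.
  - split=> //; apply: backZ (Za); rewrite -(prednK j0).
    by apply: (@passable_edge c 1 i j.-1) => //; apply: free;
      rewrite /up_x /up_y /=; clear -i0 j0; lia.
  - split=> //; apply: backZ (Zb); rewrite -(prednK i0).
    by apply: (@passable_edge c 2 i.-1 j.+1) => //; apply: free;
      rewrite /up_x /up_y /=; clear -i0 j0; lia.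
  split=> //; apply: backZ (Zd).
  by apply: (@passable_edge c 0 i.+1 j) => //; apply: free;
      rewrite /up_x /up_y /=; clear -i0 j0; lia.
apply: U3; exists (fun x y => Umax x y \/ x = X /\ y = Y); last by right.
split=> [x y [/good_Umax.1 //|[-> ->]] //|k k' i' j' kl k'l Uk nUk'].
case: Uk => [Uk|[ex ey]]; first by apply: good_Umax.2 kl k'l Uk _ => Uk'; apply: nUk'; left.
have [ek|nk] := eqVneq k k3.
  case: nUk'; have [-> ->] : i' = i /\ j' = j.
    by move: ex ey; rewrite ek /X /Y /up_x /up_y; clear; lia.
  have [->|nk'] := eqVneq k' k3; first by right.
  have : (k' == k1) || (k' == k2).
    by move: nk' k'l l1 l2 l3 n12 n13 n23; clear; lia.
  by case/orP=> /eqP->; left.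
split; first exact: free.
- by case: k kl ex ey {nk nUk'} => [|[|[|//]]] _; rewrite /up_x /up_y /= ?addn0 ?addn1 => -> ->.
- by case: k kl ex ey {nk nUk'} => [|[|[|//]]] _; rewrite /up_x /up_y /= ?addn0 ?addn1 => -> ->.
Qed.

(** A largest full triangle of [Umax] having a point of [Z] is touched by no other triangle of
    [Umax]; this isolates it and identifies its sides as edges of [Z]. *)
Lemma closed_tri_component : exists a b m, a + b + m + 3 <= n /\ closed_tri c a b m.
Proof.
have [[k [i [j [k3 ev nc]]]]|noarc] :=
  classic (exists k i j, [/\ k < 3, v0 = edge_tgt k i j & ~~ c k i j]); last first.
  (* Without incoming passable edges, [v0] alone is a closed triangle of size 0. *)
  have [] := intZ Zv0; case: v0 noarc => [[|a] [|b]] //= noarc _ _ abn.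
  exists a, b, 0; split; first lia.
  move=> k; rewrite leqn0 => /eqP->; rewrite !addn0 !addn1 subn0.
  split; apply/negPn/negP => nc; apply: noarc.
  - by exists 1, a, b.
  - by exists 0, a.+1, b.
  - by exists 2, a, b.+1.
have U0 : Umax (up_x k i) (up_y k j) by apply: edge_Umax => //; rewrite -ev.
have clo0 x y : Umax x y.+1 -> Umax x.+1 y -> Umax x y.
  by move=> u1 u2; have := @third 1 2 0 x y; rewrite /up_x /up_y /= !addn0 !addn1; apply.
have clo1 x y : Umax x y -> Umax x.+1 y -> Umax x y.+1.
  by move=> u1 u2; have := @third 0 2 1 x y; rewrite /up_x /up_y /= !addn0 !addn1; apply.
have clo2 x y : Umax x y -> Umax x y.+1 -> Umax x.+1 y.
  by move=> u1 u2; have := @third 0 1 2 x y; rewrite /up_x /up_y /= !addn0 !addn1; apply.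
pose R m := 0 < m /\ exists a b, full Umax a b m /\ exists2 z, Z z & in_tri a b m z.
have R1 : R 1.
  split=> //; exists (up_x k i), (up_y k j); split.
    move=> x y lx ly lxy; suff [-> ->] : x = up_x k i /\ y = up_y k j by [].
    by move: lx ly lxy; clear; lia.
  exists v0 => //; rewrite ev; move: k3; clear.
  by case: k => [|[|[|//]]] _; rewrite /in_tri /up_x /up_y /=; lia.
have Rn m : R m -> m <= n.
  case=> m0 [a [b [fT _]]].
  have u : Umax a (b + m.-1) by apply: fT; move: m0; clear; lia.
  by have [_ _] := good_Umax.1 _ _ u; move: m0; clear; lia.
have [m [m0 [a [b [fT [z Zz zT]]]]] nR] := max_nat Rn R1.
have absorb x y : Umax x y ->
    [|| in_tri a b m (x, y), in_tri a b m (x.+1, y) | in_tri a b m (x, y.+1)] ->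
    [&& a <= x, b <= y & x + y < a + b + m].
  move=> Uxy touch; apply/negPn/negP => out; apply: nR; split=> //.
  have [a' [b' [fT' sT]]] := full_grow clo0 clo1 clo2 fT Uxy touch out.
  by exists a', b'; split=> //; exists z => //; apply: sT.
(* The upward triangle at a passable edge of [Z] is in [Umax]; if it touches the largest triangle it
   lies inside, together with both ends of the edge. *)
have edge_in k' i' j' : k' < 3 -> ~~ c k' i' j' -> Z (edge_tgt k' i' j') ->
    in_tri a b m (edge_src k' i' j') = in_tri a b m (edge_tgt k' i' j').
  move=> k'3 nc' Zh; have /absorb := edge_Umax k'3 nc' Zh; clear -k'3.
  case: k' k'3 => [|[|[|//]]] _; rewrite /in_tri /up_x /up_y /=; lia.
have path_in x p : path (passable c) x p -> Z (last x p) ->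
    in_tri a b m x = in_tri a b m (last x p).
  elim: p x => //= y p IHp x /andP[xy yp] Zl; rewrite -(IHp _ yp Zl).
  have /andP[Zy _] := Zpath yp Zl.
  by case/passableP: xy Zy => k' [i' [j' [k'3 -> -> nc']]]; apply: edge_in.
have Zin v : Z v -> in_tri a b m v.
  have zv0 : in_tri a b m v0.
    by have [p pp lp] := connZ Zz; have := path_in _ _ pp; rewrite lp zT => <-.
  by move=> Zv; have [p pp lp] := connZ Zv; have := path_in _ _ pp; rewrite lp => ->.
(* Applied to the downward triangles just outside each side: they have a neighbour outside [Umax],
   since it would touch the largest triangle, so the sides run inside [Z]. *)
have bnd k' k'' i' j' : k' < 3 -> k'' < 3 -> Umax (up_x k' i') (up_y k' j') ->
    (Umax (up_x k'' i') (up_y k'' j') -> False) ->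
    Z (edge_src k' i' j') /\ Z (edge_tgt k' i' j').
  by move=> l l' u nu; have [] := good_Umax.2 _ _ _ _ l l' u nu.
have [a0 b0 _] : [/\ 0 < a, 0 < b & a + b + 2 <= n].
  by apply: good_Umax.1; apply: fT; move: m0; clear; lia.
have [_ _ abn] : [/\ 0 < a, 0 < b + m.-1 & a + (b + m.-1) + 2 <= n].
  by apply: good_Umax.1; apply: fT; move: m0; clear; lia.
have Zleft t : t < m -> Z (a, b + t.+1) /\ Z (a, b + t).
  move=> tm; have := bnd 2 0 a.-1 (b + t) isT isT.
  rewrite /up_x /up_y /= !addn0 addn1 (prednK a0) addnS; apply.
    by apply: fT; move: tm; clear; lia.
  move=> /absorb; rewrite /in_tri /= (prednK a0); move: tm a0; clear; lia.
have Zbot t : t < m -> Z (a + t, b) /\ Z (a + t.+1, b).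
  move=> tm; have := bnd 1 0 (a + t) b.-1 isT isT.
  rewrite /up_x /up_y /= !addn0 addn1 (prednK b0) addnS; apply.
    by apply: fT; move: tm; clear; lia.
  move=> /absorb; rewrite /in_tri /= (prednK b0); move: tm b0; clear; lia.
have Zhyp t : t < m -> Z (a + t.+1, b + m - t.+1) /\ Z (a + t, b + m - t).
  move=> tm; have := bnd 0 1 (a + t) (b + m - t.+1) isT isT.
  have -> : b + m - t = (b + m - t.+1).+1 by move: tm; clear; lia.
  rewrite /up_x /up_y /= !addn0 addn1 addnS; apply.
    by apply: fT; move: tm; clear; lia.
  move=> /absorb; rewrite /in_tri /=; move: tm; clear; lia.
have Zl t : t <= m -> Z (a, b + t).
  case: t => [|t] tm; first by have [] := Zleft 0 m0.
  by have [] := Zleft t tm.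
have Zb t : t <= m -> Z (a + t, b).
  case: t => [|t] tm; first by have [] := Zbot 0 m0.
  by have [] := Zbot t tm.
have Zh t : t <= m -> Z (a + t, b + m - t).
  case: t => [|t] tm; first by have [] := Zhyp 0 m0.
  by have [] := Zhyp t tm.
have crossed k' i' j' : k' < 3 -> Z (edge_tgt k' i' j') -> ~~ in_tri a b m (edge_src k' i' j') ->
    c k' i' j'.
  move=> k'3 Ze out; apply/negPn/negP => nc'; case/negP: out.
  by apply: Zin; apply: backZ Ze; apply: passable_edge.
(* The parameters of [closed_tri] are those of the surrounding triangle of side [m + 3], hence the
   predecessors. *)
exists a.-1, b.-1, m; split; first by move: abn m0 a0 b0; clear; lia.
move=> t tm; split; apply: crossed => //=.
- have -> : (a.-1).+1 = a by move: a0; clear; lia.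
  by have -> : (b.-1 + t).+1 = b + t by [move: b0; clear; lia]; apply: Zl.
- by rewrite /in_tri /=; move: a0; clear; lia.
- have -> : a.-1 + 1 + t = a + t by move: a0; clear; lia.
  by rewrite (prednK b0); apply: Zb.
- by rewrite /in_tri /=; move: b0; clear; lia.
- have -> : (a.-1 + t).+1 = a + t by move: a0; clear; lia.
  by have -> : b.-1 + 1 + m - t = b + m - t by [move: b0; clear; lia]; apply: Zh.
- by rewrite /in_tri /=; move: a0 b0 tm; clear; lia.
Qed.

End Component.

                

(** * Height functions and uniqueness of the terminal configuration *)

Ltac bitlia :=
  repeat match goal with |- context [nat_of_bool ?b] =>
    generalize (nat_of_bool b); intro end; clear; lia.

(** [A] is bounded, so the passable graph may be restricted to a finite square, where [A] contains a
    source component. *)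
Lemma closed_tri_of_closed n occ c (A : pred point) a0 : config n occ c -> A a0 ->
  (forall a, A a -> [/\ 0 < a.1, 0 < a.2 & a.1 + a.2 < n]) ->
  (forall a b, passable c a b -> A b -> A a) ->
  exists a b m, a + b + m + 3 <= n /\ closed_tri c a b m.
Proof.
move=> cfg Aa0 intA backA; pose V := ('I_n.+1 * 'I_n.+1)%type.
pose toN (v : V) : point := (v.1 : nat, v.2 : nat).
have ofN a : A a -> exists v, toN v = a.
  case: a => x y /intA[/= _ _ xy]; exists (inord x, inord y); rewrite /toN /=.
  by rewrite !inordK //; move: xy; clear; lia.
pose e := relpre toN (passable c); pose AV := [set v | A (toN v)].
have [u0 eu0] := ofN _ Aa0.
have [|u v|v0 Av0 conn] := @source_component V e AV u0.
- by rewrite inE eu0.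
- by rewrite !inE /e /=; apply: backA.
pose Z a := [exists v, (toN v == a) && connect e v v0].
have ZP a : reflect (exists2 v, toN v = a & connect e v v0) (Z a).
  by apply: (iffP existsP) => -[v]; [case/andP=> /eqP|move=> /eqP h1 h2]; exists v; rewrite ?h1.
have ZA a : Z a -> A a.
  by case/ZP=> v <- /conn[]; rewrite inE.
have pathN u p : path e u p -> path (passable c) (toN u) (map toN p).
  by rewrite path_map.
apply: (@closed_tri_component n occ c cfg Z (toN v0)).
- by move=> a /ZA/intA.
- move=> a b ab Zb; have [u eu] := ofN _ (backA _ _ ab (ZA _ Zb)).
  case/ZP: Zb => v ev cv; apply/ZP; exists u => //.
  by apply: connect_trans cv; apply: connect1; rewrite /e /= eu ev.
- move=> _ /ZP[v <- /conn[_ /connectP[p pp ->]]].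
  by exists (map toN p); [apply: pathN | rewrite last_map].
- move=> _ /ZP[v <- /connectP[p pp ->]].
  by exists (map toN p); [apply: pathN | rewrite last_map].
- by apply/ZP; exists v0.
Qed.

                                                                             
(** Counts the vertical pairs across the horizontal line at height [y], left of [x]. *)
Fixpoint height (c : nat -> nat -> nat -> bool) (x y : nat) : nat :=
  if x is x'.+1 then height c x' y + below c x' y else 0.

Lemma height_le c x y : height c x y <= x.
Proof. by elim: x => //= x IHx; case: (below _ _ _); lia. Qed.

Lemma height0 c x : height c x 0 = 0.
Proof. by elim: x => //= x ->. Qed.

Section Height.

Variables (n : nat) (occ : nat -> nat -> bool) (c c' : nat -> nat -> nat -> bool).
Hypotheses (cfg : config n occ c) (cfg' : config n occ c').

(** With [height_E] and [height_S]: along edge [k] the difference [height c - height c'] grows by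
    [c k i j - c' k i j], written additively in [nat]. The induction adds up the matching conditions
    of a horizontal strip, where [occ] cancels. *)
Lemma height_NW i j :
  c 0 i j + height c i.+1 j + height c' i j.+1
  = c' 0 i j + height c' i.+1 j + height c i j.+1.
Proof.
elim: i => [|i IHi].
  have := config_up cfg 0 j; have := config_up cfg' 0 j.
  by rewrite /beside /=; bitlia.
have := config_up cfg i.+1 j; have := config_up cfg' i.+1 j.
have := config_dn cfg i j; have := config_dn cfg' i j.
by move: IHi; rewrite /= /beside; bitlia.
Qed.

Lemma height_E i j :
  c 1 i j + height c i j.+1 + height c' i.+1 j.+1
  = c' 1 i j + height c' i j.+1 + height c i.+1 j.+1.
Proof. by rewrite /=; bitlia. Qed.

Lemma height_S i j :
  c 2 i j + height c i.+1 j.+1 + height c' i.+1 j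
  = c' 2 i j + height c' i.+1 j.+1 + height c i.+1 j.
Proof.
have := height_NW i j; have := height_E i j.
have := config_dn cfg i j; have := config_dn cfg' i j; bitlia.
Qed.

(** Climbing the hypotenuse from its lower right end: no downward triangle of a configuration lies
    beyond it, so no pair crosses it. *)
Lemma height_hyp i j : i + j = n -> height c i j = height c' i j.
Proof.
elim: j i => [|j IHj] i ijn; first by rewrite !height0.
have := height_NW i j; rewrite IHj; last lia.
have -> : c 0 i j = false by apply/negP => /(config_in cfg (k := 0) isT); lia.
have -> : c' 0 i j = false by apply/negP => /(config_in cfg' (k := 0) isT); lia.
by clear; lia.
Qed.

(** The excess of [height c] over [height c'] cannot increase along an edge passable for [c], so its
    maximum set is closed under predecessors; the maximum is positive, whereas the excess is zero on
    the boundary. *)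
Lemma height_lt_closed x y : x + y <= n -> height c' x y < height c x y ->
  exists a b m, a + b + m + 3 <= n /\ closed_tri c a b m.
Proof.
(* The excess shifted by [n], to remain in [nat]. *)
move=> xyn lt; pose d x y := height c x y + (n - height c' x y).
pose V := ('I_n.+1 * 'I_n.+1)%type.
have x_lt : x < n.+1 by lia.
have y_lt : y < n.+1 by lia.
pose v0 : V := (Ordinal x_lt, Ordinal y_lt).
pose F (v : V) := d v.1 v.2; pose P (v : V) := v.1 + v.2 <= n.
have [[X Y] /= XYn maxF] := @arg_maxnP _ v0 P F xyn.
have maxd i j : i + j <= n -> d i j <= d X Y.
  move=> ijn; have i_lt : i < n.+1 by lia.
  have j_lt : j < n.+1 by lia.
  exact: (maxF (Ordinal i_lt, Ordinal j_lt)).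
have dn i j : i + j <= n -> d i j = n + height c i j - height c' i j.
  by move=> ijn; rewrite /d; have := height_le c' i j; move: ijn; clear; lia.
have dM : n < d X Y.
  apply: leq_trans (maxd x y xyn); rewrite dn //; have := height_le c' x y.
  by move: lt xyn; clear; lia.
pose A (a : point) := (a.1 + a.2 <= n) && (d a.1 a.2 == d X Y).
have intA a : A a -> [/\ 0 < a.1, 0 < a.2 & a.1 + a.2 < n].
  case: a => i j /andP[/= ijn /eqP dij].
  have ne : height c i j != height c' i j.
    by apply: contraTneq dM => e; rewrite -dij dn // e; clear; lia.
  split.
  - by rewrite lt0n; apply: contra_neq ne => ->.
  - by rewrite lt0n; apply: contra_neq ne => ->; rewrite !height0.
  by rewrite ltn_neqAle ijn andbT; apply: contra_neq ne; apply: height_hyp.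
apply: (@closed_tri_of_closed _ occ c A (val X, val Y)) => //.
  by rewrite /A /= eqxx andbT.
move=> a b /passableP[k [i [j [k3 -> -> nc]]]].
move=> Ab; have [_ _ tn] := intA _ Ab; case/andP: Ab => tn' /eqP dt.
have sn : (edge_src k i j).1 + (edge_src k i j).2 <= n.
  by move: tn k3; clear; case: k => [|[|[|//]]] /=; lia.
rewrite /A sn eqn_leq maxd //= -dt !dn //; move: nc sn tn' k3; clear -cfg cfg'.
have := height_le c' (edge_src k i j).1 (edge_src k i j).2.
have := height_le c' (edge_tgt k i j).1 (edge_tgt k i j).2.
case: k => [|[|[|//]]] /=; move=> ? ? /negbTE nc ? ? _.
- by have := height_NW i j; rewrite nc /=; lia.
- by have := height_E i j; rewrite nc /=; lia.
- by have := height_S i j; rewrite nc /=; lia.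
Qed.


End Height.

(** Wherever the heights differ, the higher configuration has a closed triangle. Equal heights
    determine every [c k i j], by the three difference formulas. *)
Lemma config_eq n occ c c' : config n occ c -> config n occ c' ->
  ~ (exists a b m, a + b + m + 3 <= n /\ closed_tri c a b m) ->
  ~ (exists a b m, a + b + m + 3 <= n /\ closed_tri c' a b m) ->
  forall k i j, k < 3 -> c k i j = c' k i j.
Proof.
move=> cfg cfg' no no'.
have eqh x y : x + y <= n -> height c x y = height c' x y.
  move=> xyn; case: (ltngtP (height c x y) (height c' x y)) => // lt.
    by case: no'; apply: height_lt_closed cfg' cfg _ _ xyn lt.
  by case: no; apply: height_lt_closed cfg cfg' _ _ xyn lt.
move=> k i j k3; have [ijn|ijn] := leqP (i + j + 2) n; last first.
  by apply/idP/idP => [/(config_in cfg k3)|/(config_in cfg' k3)]; rewrite leqNgt ijn.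
have e1 : height c i.+1 j = height c' i.+1 j by apply: eqh; lia.
have e2 : height c i j.+1 = height c' i j.+1 by apply: eqh; lia.
have e3 : height c i.+1 j.+1 = height c' i.+1 j.+1 by apply: eqh; lia.
have := height_S cfg cfg' i j; have := height_E c c' i j; have := height_NW cfg cfg' i j.
rewrite e1 e2 e3 => /addIn/addIn b0 /addIn/addIn b1 /addIn/addIn b2.
by case: k k3 => [|[|[|//]]] _; [move: b0|move: b1|move: b2]; case: (c _ _ _); case: (c' _ _ _).
Qed.

                           

(** * Rhombi and tilings in coordinates *)

Definition rhomb (n k i j : nat) : {set cell n} :=
  [set x : cell n | let: (up, (p, q)) := x in
     if up then (p == up_x k i :> nat) && (q == up_y k j :> nat)
     else (p == i :> nat) && (q == j :> nat)].

Lemma in_rhomb n k i j (up : bool) (p q : 'I_n) :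
  ((up, (p, q)) \in rhomb n k i j) =
  if up then (p == up_x k i :> nat) && (q == up_y k j :> nat)
  else (p == i :> nat) && (q == j :> nat).
Proof. by rewrite inE. Qed.

Lemma up_x_ge k i : i <= up_x k i. Proof. exact: leq_addr. Qed.
Lemma up_y_ge k j : j <= up_y k j. Proof. exact: leq_addr. Qed.

Lemma share_up_dn n (p q p' q' : 'I_n) : share_edge (true, (p, q)) (false, (p', q')) ->
  exists2 k, k < 3 & up_x k p' = p /\ up_y k q' = q.
Proof.
rewrite /share_edge /= !inE !xpair_eqE.
repeat (case/orP); try done;
  move=> /andP[/andP[/eqP h1 /eqP h2] /andP[/eqP h3 /eqP h4]]; 
  match goal with
  | _ : nat_of_ord q = (nat_of_ord q').+1 |- _ => exists 1
  | _ : nat_of_ord q = nat_of_ord q', _ : nat_of_ord p = nat_of_ord p' |- _ => exists 0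
  | _ => exists 2 end; rewrite // /up_x /up_y /=; clear -h1 h2 h3 h4; lia.
Qed.

Lemma share_same n up (p q p' q' : 'I_n) : share_edge (up, (p, q)) (up, (p', q')) ->
  p = p' /\ q = q'.
Proof.
rewrite /share_edge; case: up; rewrite /= !inE !xpair_eqE;
repeat (case/orP); try done;
  move=> /andP[/andP[/eqP h1 /eqP h2] /andP[/eqP h3 /eqP h4]]; 
  split; apply: val_inj; rewrite /=; clear -h1 h2 h3 h4; lia.
Qed.

Lemma adjacent_rhomb n (p q p' q' : 'I_n) : share_edge (true, (p, q)) (false, (p', q')) ->
  exists2 k, k < 3 & [/\ up_x k p' = p, up_y k q' = q
    & [set (true, (p, q)); (false, (p', q'))] = rhomb n k p' q'].
Proof.
move=> sh.
have [k k3 [ex ey]] := share_up_dn sh.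
exists k => //; split=> //; apply/setP => -[up [x y]].
by rewrite in_rhomb !inE ex ey !xpair_eqE; case: up; rewrite ?andbF ?orbF.
Qed.

Lemma share_edgeC n (c d : cell n) : share_edge c d = share_edge d c.
Proof.
by apply/hasP/hasP => -[e e1 e2]; exists e.
Qed.

Lemma rhombusP n (B : {set cell n}) :
  reflect (exists k i j, [/\ k < 3, up_x k i < n, up_y k j < n & B = rhomb n k i j]) (rhombus B).
Proof.
apply: (iffP existsP) => [[c /existsP[d /and3P[cd sh /eqP->]]]|].
  move: c d cd sh => [[] [p q]] [[] [p' q']] cd sh.
  - by have [ep eq_q] := share_same sh; rewrite ep eq_q eqxx in cd.
  - have [k k3 [ex ey ->]] := adjacent_rhomb sh.
    by exists k, p', q'; split=> //; rewrite ?ex ?ey.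
  - rewrite share_edgeC in sh; have [k k3 [ex ey]] := adjacent_rhomb sh.
    rewrite setUC => ->.
    by exists k, p, q; split=> //; rewrite ?ex ?ey.
  - by have [ep eq_q] := share_same sh; rewrite ep eq_q eqxx in cd.
move=> [k [i [j [k3 xn yn ->]]]].
have ilt := leq_ltn_trans (up_x_ge k i) xn; have jlt := leq_ltn_trans (up_y_ge k j) yn.
exists (true, (Ordinal xn, Ordinal yn)); apply/existsP.
exists (false, (Ordinal ilt, Ordinal jlt)); apply/and3P; split=> //.
  rewrite /share_edge /= !inE !xpair_eqE /up_x /up_y.
  by case: (k) k3 => [|[|[|//]]] _; rewrite ?addn0 ?addn1 !eqxx ?orbT.
apply/eqP/setP => -[up [x y]].
by rewrite in_rhomb !inE !xpair_eqE; case: up; rewrite ?andbF ?orbF.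
Qed.

(** Being a rhombus ensures that both cells are in range: the downward one gives [i] and [j], the
    upward one then gives [k]. *)
Lemma rhomb_inj n k i j k' i' j' : k < 3 -> rhombus (rhomb n k' i' j') -> k' < 3 ->
  rhomb n k i j = rhomb n k' i' j' -> [/\ k = k', i = i' & j = j'].
Proof.
move=> k3 + k'3 e; rewrite -e; case/rhombusP=> k2 [i2 [j2 [k23 xn yn e2]]].
have ilt := leq_ltn_trans (up_x_ge k2 i2) xn; have jlt := leq_ltn_trans (up_y_ge k2 j2) yn.
have h1 : (false, (Ordinal ilt, Ordinal jlt)) \in rhomb n k2 i2 j2 by rewrite in_rhomb /= !eqxx.
have h2 : (true, (Ordinal xn, Ordinal yn)) \in rhomb n k2 i2 j2 by rewrite in_rhomb /= !eqxx.
have := h1; have := h2; rewrite -e2 !in_rhomb /= => /andP[/eqP ex /eqP ey] /andP[/eqP ei /eqP ej].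
move: h1 h2; rewrite -e2 e !in_rhomb /= => /andP[/eqP ei' /eqP ej'] /andP[/eqP ex' /eqP ey'].
subst i2 j2 i' j'; split=> //; move: ex ey; rewrite ex' ey' /up_x /up_y.
move=> /addnI/eqP ex /addnI/eqP ey; move: k3 k'3 ex ey; clear.
by case: k => [|[|[|//]]] _; case: k' => [|[|[|//]]].
Qed.

Lemma rhomb_range n k i j : k < 3 -> rhombus (rhomb n k i j) -> up_x k i < n /\ up_y k j < n.
Proof.
move=> k3 rB; have /rhombusP[k' [i' [j' [k'3 xn yn e]]]] := rB.
by rewrite e in rB; have [-> -> ->] := rhomb_inj k3 rB k'3 e.
Qed.

Lemma tilingP n (D : {set cell n}) (P : {set {set cell n}}) :
  tiling D P <->
  [/\ forall B, B \in P -> rhombus B, forall B, B \in P -> B \subset D,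
      forall x, x \in D -> exists2 B, B \in P & x \in B
    & forall B B' x, B \in P -> B' \in P -> x \in B -> x \in B' -> B = B'].
Proof.
split=> [/andP[/and3P[/eqP cov /trivIsetP tri _] /forallP rP]|[rP sP cP uP]].
  split.
  - by move=> B BP; have := rP B; rewrite BP.
  - by move=> B BP; rewrite -cov; apply: bigcup_sup.
  - by move=> x; rewrite -cov => /bigcupP[B]; exists B.
  - move=> B B' x BP B'P xB xB'; apply/eqP/negPn/negP => /(tri _ _ BP B'P).
    by move=> /disjointFr/(_ xB); rewrite xB'.
apply/andP; split; last by apply/forallP=> B; apply/implyP/rP.
apply/and3P; split.
- apply/eqP/setP => x; apply/bigcupP/idP => [[B BP]|/cP[B BP xB]]; last by exists B.
  exact: (subsetP (sP B BP)).
- apply/trivIsetP => B B' BP B'P; apply: contraNT => /pred0Pn[x /andP[/= xB xB']].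
  by apply/eqP; apply: uP xB xB'.
- apply/negP => /rP/rhombusP[k [i [j [k3 xn yn e]]]].
  have : (true, (Ordinal xn, Ordinal yn)) \in rhomb n k i j by rewrite in_rhomb /= !eqxx.
  by rewrite -e inE.
Qed.

(** The cells of [X] are already covered by [G], so the rhombi of [P] outside [G] avoid [X]. *)
Lemma tiling_exchange n (D X : {set cell n}) (P G H : {set {set cell n}}) :
  tiling D P -> G \subset P -> tiling X G -> tiling X H ->
  tiling D ((P :\: G) :|: H).
Proof.
move=> /tilingP[rP sP cP uP] /subsetP GP /tilingP[rG sG cG uG] /tilingP[rH sH cH uH].
have XD x : x \in X -> x \in D.
  by move=> /cG[B /GP/sP/subsetP sB xB]; apply: sB.
have offX B x : B \in P -> B \notin G -> x \in B -> x \notin X.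
  move=> BP BG xB; apply/negP=> /cG[B' B'G xB'].
  by rewrite (uP B B' x BP (GP _ B'G) xB xB') B'G in BG.
apply/tilingP; split.
- by move=> B; rewrite !inE => /orP[/andP[_ /rP]|/rH].
- move=> B; rewrite !inE => /orP[/andP[_ /sP //]|/sH/subsetP sB].
  by apply/subsetP=> x /sB/XD.
- move=> x /cP[B BP xB]; have [BG|BG] := boolP (B \in G).
    have [|B' B'H xB'] := cH x; first exact: (subsetP (sG _ BG)).
    by exists B'; rewrite // !inE B'H orbT.
  by exists B; rewrite // !inE BG BP.
move=> B B' x; rewrite !inE => /orP[/andP[BG BP]|BH] /orP[/andP[B'G B'P]|B'H] xB xB'.
- exact: uP xB xB'.
- by have := offX _ _ BP BG xB; rewrite (subsetP (sH _ B'H) _ xB').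
- by have := offX _ _ B'P B'G xB'; rewrite (subsetP (sH _ BH) _ xB).
- exact: uH xB xB'.
Qed.

(** * The configuration of a tiling *)

Section Configuration.

Variables (n : nat) (S : {set hole n}) (P : {set {set cell n}}).
Hypothesis tilP : tiling (holed_region S) P.

Definition up_hole (i j : nat) : bool :=
  [exists s in S, [&& s.1.1 <= i, s.1.2 <= j & i + j < s.1.1 + s.1.2 + s.2]].

Definition dn_hole (i j : nat) : bool :=
  [exists s in S, [&& s.1.1 <= i, s.1.2 <= j & (i + j).+1 < s.1.1 + s.1.2 + s.2]].

Lemma dn_up_hole k i j : k < 3 -> dn_hole i j -> up_hole (up_x k i) (up_y k j).
Proof.
move=> k3 /existsP[s /and4P[sS h1 h2 h3]]; apply/existsP; exists s.
rewrite sS /up_x /up_y; move: k3 h1 h2 h3; clear; lia.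
Qed.

Lemma in_holed_region (up : bool) (p q : 'I_n) :
  ((up, (p, q)) \in holed_region S) =
  if up then (p + q < n) && ~~ up_hole p q else ((p + q).+1 < n) && ~~ dn_hole p q.
Proof.
rewrite /holed_region in_setD; have -> : ((up, (p, q)) \in \bigcup_(s in S) hole_cells s) =
    if up then up_hole p q else dn_hole p q.
  apply/bigcupP/idP => [[s sS]|].
    rewrite inE; case: up => h; apply/existsP; exists s; rewrite sS; exact: h.
  by case: up => /existsP[s /andP[sS h]]; exists s => //; rewrite inE; exact: h.
by rewrite !inE /=; case: up; rewrite andbC ?add0n.
Qed.

                                                                          
(** Each downward triangle of a hole is matched with the upward one above it, so that the matched
    upward triangles, [tiling_occ], do not depend on [P]. *)
Definition tiling_config (k i j : nat) : bool :=
  (i + j + 2 <= n) && ((rhomb n k i j \in P) || ((k == 1) && dn_hole i j)).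

Definition tiling_occ (i j : nat) : bool :=
  (i + j < n) && (~~ up_hole i j || (if j is j'.+1 then dn_hole i j' else false)).

Lemma rhomb_in_holed_region k i j : k < 3 -> rhomb n k i j \in P ->
  [/\ i + j + 2 <= n, ~~ dn_hole i j & ~~ up_hole (up_x k i) (up_y k j)].
Proof.
case/tilingP: tilP => rP sP _ _ k3 kP; have [xn yn] := rhomb_range k3 (rP _ kP).
have ilt := leq_ltn_trans (up_x_ge k i) xn; have jlt := leq_ltn_trans (up_y_ge k j) yn.
have h1 : (false, (Ordinal ilt, Ordinal jlt)) \in rhomb n k i j by rewrite in_rhomb /= !eqxx.
have h2 : (true, (Ordinal xn, Ordinal yn)) \in rhomb n k i j by rewrite in_rhomb /= !eqxx.
have := subsetP (sP _ kP) _ h1; have := subsetP (sP _ kP) _ h2.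
rewrite !in_holed_region /= => /andP[_ ->] /andP[h3 ->]; split=> //.
by move: h3; clear; lia.
Qed.

Lemma tiling_uniq_up k i j k' i' j' : k < 3 -> k' < 3 ->
  rhomb n k i j \in P -> rhomb n k' i' j' \in P ->
  up_x k i = up_x k' i' -> up_y k j = up_y k' j' -> [/\ k = k', i = i' & j = j'].
Proof.
case/tilingP: tilP => rP _ _ uP k3 k'3 kP k'P ex ey.
have [xn yn] := rhomb_range k3 (rP _ kP).
apply: rhomb_inj => //; first exact: rP.
by apply: (uP _ _ (true, (Ordinal xn, Ordinal yn))) => //; rewrite in_rhomb /= ?ex ?ey !eqxx.
Qed.

Lemma tiling_uniq_dn k k' i j : k < 3 -> k' < 3 ->
  rhomb n k i j \in P -> rhomb n k' i j \in P -> k = k'.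
Proof.
case/tilingP: tilP => rP _ _ uP k3 k'3 kP k'P.
have [xn yn] := rhomb_range k3 (rP _ kP).
have ilt := leq_ltn_trans (up_x_ge k i) xn; have jlt := leq_ltn_trans (up_y_ge k j) yn.
suff /(rhomb_inj k3 (rP _ k'P) k'3)[] : rhomb n k i j = rhomb n k' i j by [].
by apply: (uP _ _ (false, (Ordinal ilt, Ordinal jlt))) => //; rewrite in_rhomb /= !eqxx.
Qed.

Lemma tiling_configP : config n tiling_occ tiling_config.
Proof.
have [rP sP cP uP] := iffLR (tilingP _ _) tilP; split=> i j.
  rewrite /tiling_config; case: leqP => //= ijn; case hole: (dn_hole i j).
    have no k : k < 3 -> (rhomb n k i j \in P) = false.
      by move=> k3; apply/negP => /(rhomb_in_holed_region k3)[_]; rewrite hole.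
    by rewrite !no.
  have ilt : i < n by move: ijn; clear; lia.
  have jlt : j < n by move: ijn; clear; lia.
  have [|B BP] := cP (false, (Ordinal ilt, Ordinal jlt)).
    by rewrite in_holed_region /= hole andbT; move: ijn; clear; lia.
  have /rhombusP[k [i' [j' [k3 _ _ eB]]]] := rP B BP.
  rewrite eB in_rhomb /= => /andP[/eqP ei /eqP ej]; subst i' j' B.
  have other k' : k' < 3 -> (rhomb n k' i j \in P) = (k' == k).
    by move=> k'3; apply/idP/eqP => [h|->//]; apply: tiling_uniq_dn h BP.
  by rewrite ?andbF ?orbF !other //; case: k k3 {BP other} => [|[|[|//]]] _.
have [ijn|ijn] := leqP n (i + j).
  rewrite /tiling_occ ltnNge ijn /=.
  have -> : tiling_config 0 i j = false.
    by rewrite /tiling_config; move: ijn; clear; lia.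
  have -> : below tiling_config i j = false.
    by case: j ijn => //= j; rewrite /tiling_config; clear; lia.
  by case: i ijn => //= i; rewrite /tiling_config; clear; lia.
have ilt : i < n by move: ijn; clear; lia.
have jlt : j < n by move: ijn; clear; lia.
have -> : tiling_occ i j = ~~ up_hole i j || (if j is j'.+1 then dn_hole i j' else false).
  by rewrite /tiling_occ ijn.
have c0E : tiling_config 0 i j = (rhomb n 0 i j \in P).
  rewrite /tiling_config orbF; apply/andP/idP => [[] //|h].
  by have [] := rhomb_in_holed_region (isT : 0 < 3) h.
have c2E : beside tiling_config i j = (if i is i'.+1 then rhomb n 2 i' j \in P else false).
  case: (i) => //= i'; rewrite /tiling_config orbF; apply/andP/idP => [[] //|h].
  by have [] := rhomb_in_holed_region (isT : 2 < 3) h.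
have c1E : below tiling_config i j
    = (if j is j'.+1 then (rhomb n 1 i j' \in P) || dn_hole i j' else false).
  case: (j) ijn => //= j' ij'; rewrite /tiling_config /=.
  by have -> : i + j' + 2 <= n by move: ij'; clear; lia.
rewrite c0E c1E c2E {c0E c1E c2E}.
case hole: (up_hole i j).
  have no k i' j' : k < 3 -> up_x k i' = i -> up_y k j' = j -> (rhomb n k i' j' \in P) = false.
    by move=> k3 ex ey; apply/negP => /(rhomb_in_holed_region k3)[_ _]; rewrite ex ey hole.
  rewrite (no 0) //; try by rewrite /up_x /up_y /= addn0.
  have -> : (if i is i'.+1 then rhomb n 2 i' j \in P else false) = false.
    by case: (i) no => // i' no; apply: no; rewrite /up_x /up_y /= ?addn1 ?addn0.
  case: (j) no => //= j' no; rewrite (no 1) //; last by rewrite /up_y /= addn1.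
    by case: (dn_hole _ _).
  by rewrite /up_x /= addn0.
have [|B BP] := cP (true, (Ordinal ilt, Ordinal jlt)).
  by rewrite in_holed_region /= hole andbT; move: ijn; clear; lia.
have /rhombusP[k [i' [j' [k3 _ _ eB]]]] := rP B BP.
rewrite eB in_rhomb /= => /andP[/eqP ei /eqP ej]; subst B.
have other k' i2 j2 : k' < 3 -> up_x k' i2 = i -> up_y k' j2 = j ->
    (rhomb n k' i2 j2 \in P) = (k' == k).
  move=> k'3 ex ey; apply/idP/eqP => [h|ek].
    by have [] := tiling_uniq_up k'3 k3 h BP; rewrite ?ex ?ey.
  move: BP; rewrite -ek; rewrite -ek in ei ej.
  have -> : i' = i2 by apply: (@addIn (k' == 2)); rewrite -[RHS]/(up_x k' i2) ex ei.
  by have -> : j' = j2 by apply: (@addIn (k' == 1)); rewrite -[RHS]/(up_y k' j2) ey ej.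
have nohole j2 : j = j2.+1 -> dn_hole i j2 = false.
  move=> ej2; case h: (dn_hole i j2) => //; have := dn_up_hole (isT : 1 < 3) h.
  by rewrite /up_x /up_y /= addn0 addn1 -ej2 hole.
rewrite (other 0) //; try by rewrite /up_x /up_y /= addn0.
have -> : (if i is i2.+1 then rhomb n 2 i2 j \in P else false) = (2 == k).
  move: other; case: (i) ei => [|i2] ei other; last first.
    by apply: other; rewrite /up_x /up_y /= ?addn1 ?addn0.
  by move: ei; rewrite /up_x; clear; lia.
have -> : (if j is j2.+1 then (rhomb n 1 i j2 \in P) || dn_hole i j2 else false) = (1 == k).
  move: other nohole; case: (j) ej => [|j2] ej other nohole.
    by move: ej; rewrite /up_y; clear; lia.
  by rewrite (nohole j2) // orbF; apply: other; rewrite /up_x /up_y /= ?addn1 ?addn0.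
by move: k3; clear; lia.
Qed.

End Configuration.

                                       

                                                                                
(** * The two tilings of a GD region *)

(** The pairs of [closed_tri]; the vertical ones ([k = 1]) stand along the left side, while those of
    [ccw_edge] stand along the hypotenuse. *)
Definition cw_edge (a b m k i j : nat) : bool :=
  match k with
  | 0 => [&& j == b, a < i & i <= a + m + 1]
  | 1 => [&& i == a, b <= j & j <= b + m]
  | _ => [&& i + j == a + b + m + 1, a <= i & i <= a + m]
  end.

Definition ccw_edge (a b m k i j : nat) : bool :=
  match k with
  | 0 => [&& i == a, b < j & j <= b + m + 1]
  | 1 => [&& i + j == a + b + m + 1, b <= j & j <= b + m]
  | _ => [&& j == b, a <= i & i <= a + m]
  end.

Definition rhombs (n : nat) (e : nat -> nat -> nat -> bool) : {set {set cell n}} :=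
  [set B : {set cell n} | [exists k : 'I_3, exists i : 'I_n, exists j : 'I_n,
     e k i j && (B == rhomb n k i j)]].

Definition in_range (n : nat) (e : nat -> nat -> nat -> bool) : Prop :=
  forall k i j, k < 3 -> e k i j -> i + j + 2 <= n.

Lemma in_rhombs n e B : in_range n e ->
  reflect (exists k i j, [/\ k < 3, e k i j & B = rhomb n k i j]) (B \in rhombs n e).
Proof.
move=> ran; apply: (iffP idP); rewrite inE.
  case/existsP=> k /existsP[i /existsP[j /andP[ek /eqP->]]].
  by exists k, i, j; split.
move=> [k [i [j [k3 ek ->]]]]; have ijn := ran _ _ _ k3 ek.
have ilt : i < n by move: ijn; clear; lia.
have jlt : j < n by move: ijn; clear; lia.
apply/existsP; exists (Ordinal k3); apply/existsP; exists (Ordinal ilt).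
by apply/existsP; exists (Ordinal jlt); rewrite ek eqxx.
Qed.

Lemma rhombus_rhomb n k i j : k < 3 -> i + j + 2 <= n -> rhombus (rhomb n k i j).
Proof.
move=> k3 ijn; apply/rhombusP; exists k, i, j; split=> //;
  move: k3 ijn; rewrite /up_x /up_y; clear; lia.
Qed.

Lemma rhomb_in_rhombs n e k i j : in_range n e -> k < 3 -> (rhomb n k i j \in rhombs n e) = e k i j.
Proof.
move=> ran k3; apply/(in_rhombs _ ran)/idP => [|ek]; last by exists k, i, j.
move=> [k' [i' [j' [k'3 ek E]]]].
by have [-> -> ->] := rhomb_inj k3 (rhombus_rhomb k'3 (ran _ _ _ k'3 ek)) k'3 E.
Qed.

(** Turns being a tiling into inequalities on coordinates, which [lia] settles for both GD
    tilings. *)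
Lemma tiling_rhombs n e (X : {set cell n}) : in_range n e ->
  (forall k i j (p q : 'I_n), k < 3 -> e k i j -> p = i :> nat -> q = j :> nat ->
     (false, (p, q)) \in X) ->
  (forall k i j (p q : 'I_n), k < 3 -> e k i j -> p = up_x k i :> nat ->
     q = up_y k j :> nat -> (true, (p, q)) \in X) ->
  (forall p q : 'I_n, (false, (p, q)) \in X -> exists2 k, k < 3 & e k p q) ->
  (forall p q : 'I_n, (true, (p, q)) \in X ->
     exists k i j, [/\ k < 3, e k i j, up_x k i = p & up_y k j = q]) ->
  (forall k k' i j, k < 3 -> k' < 3 -> e k i j -> e k' i j -> k = k') ->
  (forall k k' i j i' j', k < 3 -> k' < 3 -> e k i j -> e k' i' j' ->
     up_x k i = up_x k' i' -> up_y k j = up_y k' j' -> [/\ k = k', i = i' & j = j']) ->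
  tiling X (rhombs n e).
Proof.
move=> ran sdn sup cdn cup udn uup; apply/tilingP; split.
- move=> _ /(in_rhombs _ ran)[k [i [j [k3 ek ->]]]].
  exact: rhombus_rhomb k3 (ran _ _ _ k3 ek).
- move=> _ /(in_rhombs _ ran)[k [i [j [k3 ek ->]]]].
  apply/subsetP => -[[] [p q]]; rewrite in_rhomb => /andP[/eqP h1 /eqP h2].
    exact: sup k3 ek h1 h2.
  exact: sdn k3 ek h1 h2.
- move=> [[] [p q]].
    move=> /cup[k [i [j [k3 ek ex ey]]]]; exists (rhomb n k i j).
      by rewrite rhomb_in_rhombs.
    by rewrite in_rhomb ex ey !eqxx.
  by move=> /cdn[k k3 ek]; exists (rhomb n k p q); rewrite ?rhomb_in_rhombs // in_rhomb !eqxx.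
move=> _ _ [up [p q]] /(in_rhombs _ ran)[k [i [j [k3 ek ->]]]]
  /(in_rhombs _ ran)[k' [i' [j' [k'3 ek' ->]]]]; rewrite !in_rhomb; case: up.
  move=> /andP[/eqP ex /eqP ey] /andP[/eqP ex' /eqP ey'].
  by have [||-> -> ->] := uup _ _ _ _ _ _ k3 k'3 ek ek'; rewrite -?ex -?ey.
move=> /andP[/eqP ei /eqP ej] /andP[/eqP ei' /eqP ej'].
rewrite -ei -ej in ek *; rewrite -ei' -ej' in ek' *.
by rewrite (udn _ _ _ _ k3 k'3 ek ek').
Qed.

Section GD.

Variables (n a b m : nat).
Hypothesis abm : a + b + (m + 3) <= n.

Lemma cw_range : in_range n (cw_edge a b m).
Proof. by move=> [|[|[|//]]] i j _ /and3P[/eqP h1 h2 h3]; move: abm h1 h2 h3; clear; lia. Qed.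

Lemma ccw_range : in_range n (ccw_edge a b m).
Proof. by move=> [|[|[|//]]] i j _ /and3P[/eqP h1 h2 h3]; move: abm h1 h2 h3; clear; lia. Qed.

Lemma in_GD (up : bool) (p q : 'I_n) :
  ((up, (p, q)) \in GD_region n a b m) =
  if up then
    [&& a <= p, b <= q, p + q <= a + b + m + 2 &
      [|| [&& p == a :> nat, b < q & q <= b + m + 1],
          [&& q == b :> nat, a < p & p <= a + m + 1]
        | [&& p + q == a + b + m + 2, a < p & b < q]]]
  else
    [&& a <= p, b <= q, p + q <= a + b + m + 1 &
      [|| p == a :> nat, q == b :> nat | p + q == a + b + m + 1]].
Proof.
rewrite /GD_region !inE; move: (p : nat) (q : nat) => x y.
by case: up; clear; lia.
Qed.


Lemma tiling_cw : tiling (GD_region n a b m) (rhombs n (cw_edge a b m)).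
Proof.
apply: tiling_rhombs; first exact: cw_range.
- move=> k i j p q k3 ek ep eq_; rewrite in_GD ep eq_; move: k3 ek; clear.
  by case: k => [|[|[|//]]] _; rewrite /cw_edge; lia.
- move=> k i j p q k3 ek ep eq_; rewrite in_GD ep eq_; move: k3 ek; clear.
  by case: k => [|[|[|//]]] _; rewrite /cw_edge /up_x /up_y /=; lia.
- move=> p q; rewrite in_GD; move: (p : nat) (q : nat) => x y h.
  have : [|| cw_edge a b m 0 x y, cw_edge a b m 1 x y | cw_edge a b m 2 x y].
    by move: h; rewrite /cw_edge; clear; lia.
  by case/or3P; [exists 0|exists 1|exists 2].
- move=> p q; rewrite in_GD; move: (p : nat) (q : nat) => x y /and4P[ax by_ xy].
  case/or3P=> /and3P[/eqP h1 h2 h3].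
  + exists 1, x, y.-1; split=> //; rewrite /cw_edge /up_x /up_y /=; move: h1 h2 h3; clear; lia.
  + exists 0, x, y; split=> //; rewrite /cw_edge /up_x /up_y /=; move: h1 h2 h3; clear; lia.
  + exists 2, x.-1, y; split=> //; rewrite /cw_edge /up_x /up_y /=; move: h1 h2 h3; clear; lia.
- move=> k k' i j; clear.
  by case: k => [|[|[|//]]]; case: k' => [|[|[|//]]] //; rewrite /cw_edge; lia.
- move=> k k' i j i' j'; clear.
  by case: k => [|[|[|//]]]; case: k' => [|[|[|//]]] _ _; rewrite /cw_edge /up_x /up_y /=; 
    split; lia.
Qed.

Lemma tiling_ccw : tiling (GD_region n a b m) (rhombs n (ccw_edge a b m)).
Proof.
apply: tiling_rhombs; first exact: ccw_range.
- move=> k i j p q k3 ek ep eq_; rewrite in_GD ep eq_; move: k3 ek; clear.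
  by case: k => [|[|[|//]]] _; rewrite /ccw_edge; lia.
- move=> k i j p q k3 ek ep eq_; rewrite in_GD ep eq_; move: k3 ek; clear.
  by case: k => [|[|[|//]]] _; rewrite /ccw_edge /up_x /up_y /=; lia.
- move=> p q; rewrite in_GD; move: (p : nat) (q : nat) => x y h.
  have : [|| ccw_edge a b m 0 x y, ccw_edge a b m 1 x y | ccw_edge a b m 2 x y].
    by move: h; rewrite /ccw_edge; clear; lia.
  by case/or3P; [exists 0|exists 1|exists 2].
- move=> p q; rewrite in_GD; move: (p : nat) (q : nat) => x y /and4P[ax by_ xy].
  case/or3P=> /and3P[/eqP h1 h2 h3].
  + exists 0, x, y; split=> //; rewrite /ccw_edge /up_x /up_y /=; move: h1 h2 h3; clear; lia.
  + exists 2, x.-1, y; split=> //; rewrite /ccw_edge /up_x /up_y /=; move: h1 h2 h3; clear; lia.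
  + exists 1, x, y.-1; split=> //; rewrite /ccw_edge /up_x /up_y /=; move: h1 h2 h3; clear; lia.
- move=> k k' i j; clear.
  by case: k => [|[|[|//]]]; case: k' => [|[|[|//]]] //; rewrite /ccw_edge; lia.
- move=> k k' i j i' j'; clear.
  by case: k => [|[|[|//]]]; case: k' => [|[|[|//]]] _ _; rewrite /ccw_edge /up_x /up_y /=; 
    split; lia.
Qed.

End GD.

Definition dn_edges (i j : nat) : seq (point * point) :=
  [:: ((i, j.+1), (i.+1, j.+1)); ((i.+1, j), (i.+1, j.+1)); ((i.+1, j), (i, j.+1))].

Definition up_edges (i j : nat) : seq (point * point) :=
  [:: ((i, j), (i.+1, j)); ((i, j), (i, j.+1)); ((i.+1, j), (i, j.+1))].

Lemma rhombus_edgeE n k i j e : k < 3 -> i + j + 2 <= n ->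
  rhombus_edge (rhomb n k i j) e =
  (e \in dn_edges i j) (+) (e \in up_edges (up_x k i) (up_y k j)).
Proof.
move=> k3 ijn; have [xn yn] := rhomb_range k3 (rhombus_rhomb k3 ijn).
have ilt := leq_ltn_trans (up_x_ge k i) xn; have jlt := leq_ltn_trans (up_y_ge k j) yn.
pose x : cell n := (false, (Ordinal ilt, Ordinal jlt)).
pose y : cell n := (true, (Ordinal xn, Ordinal yn)).
have edx : edges x = dn_edges i j by [].
have edy : edges y = up_edges (up_x k i) (up_y k j) by [].
have -> : rhomb n k i j = [set x; y].
  apply/setP => -[up [p q]]; rewrite in_rhomb !inE !xpair_eqE.
  by case: up; rewrite ?orbF.
have xy : x != y by [].
rewrite -edx -edy /rhombus_edge.
have [ex|ex] := boolP (e \in edges x); have [ey|ey] := boolP (e \in edges y).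
- suff -> : [set c in [set x; y] | e \in edges c] = [set x; y] by rewrite cards2 xy.
  apply/setP => c; rewrite !inE.
  by have [->|_] := eqVneq c x; rewrite ?ex //=; have [->|] := eqVneq c y; rewrite ?ey.
- suff -> : [set c in [set x; y] | e \in edges c] = [set x] by rewrite cards1.
  apply/setP => c; rewrite !inE.
  by have [->|_] := eqVneq c x; rewrite ?ex //=; have [->|] := eqVneq c y; rewrite ?(negbTE ey).
- suff -> : [set c in [set x; y] | e \in edges c] = [set y] by rewrite cards1.
  apply/setP => c; rewrite !inE.
  have [->|_] := eqVneq c x; first by rewrite (negbTE ex) (negbTE xy).
  by have [->|] := eqVneq c y; rewrite ?ey.
suff -> : [set c in [set x; y] | e \in edges c] = set0 by rewrite cards0.
apply/setP => c; rewrite !inE.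
by have [->|_] := eqVneq c x; rewrite ?(negbTE ex) //=;
  have [->|] := eqVneq c y; rewrite ?(negbTE ey).
Qed.

Lemma vertical_rhomb n k i j : k < 3 -> i + j + 2 <= n -> (vertical (rhomb n k i j) <-> k = 1).
Proof.
move=> k3 ijn; split=> [[_ ver]|k1].
  have := ver ((i, j.+1), (i.+1, j.+1)); rewrite rhombus_edgeE // /horizontal /= eqxx.
  case: k k3 {ver} => [|[|[|//]]] _ //;
    rewrite !inE !xpair_eqE /up_x /up_y /= ?addn0 ?addn1 !eqxx /= => h; exfalso;
    have := h; clear; lia.
split=> [|e]; first exact: rhombus_rhomb.
rewrite rhombus_edgeE // k1 /horizontal; case: e => [[x y] [x' y']].
rewrite !inE !xpair_eqE /up_x /up_y /= addn0 addn1; clear; lia.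
Qed.

Lemma along_left_rhomb n a j : a + j + 2 <= n -> along_left a (rhomb n 1 a j).
Proof.
move=> ajn; exists ((a, j.+1), (a, j.+2)); rewrite rhombus_edgeE //; split=> //.
rewrite !inE !xpair_eqE /up_x /up_y /= addn0 addn1; clear; lia.
Qed.

Lemma not_along_left_rhomb n a k i j : k < 3 -> i + j + 2 <= n -> a < i ->
  ~ along_left a (rhomb n k i j).
Proof.
move=> k3 ijn ai [[[x y] [x' y']] [+ /= ea ea']]; rewrite rhombus_edgeE //.
rewrite !inE !xpair_eqE ea ea'; have := up_x_ge k i; move: (up_x k i) (up_y k j) => X Y.
by move: ai; clear; lia.
Qed.

Lemma CW_GD_rhombs n a b m : a + b + (m + 3) <= n -> CW_GD a b m (rhombs n (cw_edge a b m)).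
Proof.
move=> abm; split=> [|B]; first exact: tiling_cw.
case/(in_rhombs _ (cw_range abm))=> k [i [j [k3 ek ->]]].
have ijn := cw_range abm k3 ek.
case/(vertical_rhomb k3 ijn) => k1; move: ek ijn; rewrite k1 => /and3P[/eqP-> _ _].
exact: along_left_rhomb.
Qed.

Lemma CCW_GD_rhombs n a b m : a + b + (m + 3) <= n -> CCW_GD a b m (rhombs n (ccw_edge a b m)).
Proof.
move=> abm; split=> [|[_ left]]; first exact: tiling_ccw.
(* The topmost vertical rhombus of this tiling is off the left side. *)
have ran := ccw_range abm; have e1 : ccw_edge a b m 1 a.+1 (b + m).
  by rewrite /ccw_edge; clear; lia.
have ijn := ran _ _ _ (isT : 1 < 3) e1.
apply: (not_along_left_rhomb (isT : 1 < 3) ijn (leqnn _)); apply: left.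
  by rewrite rhomb_in_rhombs.
exact/vertical_rhomb.
Qed.

(** * Flipping a closed triangle *)

Definition potential (n : nat) (P : {set {set cell n}}) : nat :=
  \sum_(j < n) \sum_(i < n) (rhomb n 1 i j \in P) * i.

Lemma potential_le n (P : {set {set cell n}}) : potential P <= \sum_(j < n) \sum_(i < n) i.
Proof.
apply: leq_sum => j _; apply: leq_sum => i _.
by case: (_ \in _); rewrite ?mul1n.
Qed.

(** For a row met by a flip: one vertical rhombus jumps from [i0] to the right, to [i1]. *)
Lemma row_sum_lt n (p q : 'I_n -> bool) (i0 i1 : 'I_n) : p i0 -> ~~ p i1 -> i0 < i1 ->
  (forall i, q i = (p i && (i != i0)) || (i == i1)) ->
  \sum_(i < n) p i * i < \sum_(i < n) q i * i.
Proof.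
move=> p0 p1 lt Eq; have ne : i1 != i0 by rewrite neq_ltn lt orbT.
rewrite (bigD1 i0) //= [X in _ < X](bigD1 i0) //= (bigD1 i1) //=.
rewrite [X in _ < _ + X](bigD1 i1) //= !Eq p0 (negbTE p1) !eqxx eq_sym (negbTE ne) /=.
under [X in _ < _ + (_ + X)]eq_bigr => i /andP[i_0 i_1].
  rewrite Eq i_0 (negbTE i_1) andbT orbF; over.
by move: lt; clear; lia.
Qed.

Section Flip.

Variables (n : nat) (S : {set hole n}) (P : {set {set cell n}}).
Hypothesis tilP : tiling (holed_region S) P.
Variables (a b m : nat).
Hypothesis abm : a + b + (m + 3) <= n.
Hypothesis clo : closed_tri (tiling_config S P) a b m.

Let Q := (P :\: rhombs n (cw_edge a b m)) :|: rhombs n (ccw_edge a b m).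

                                                                               
                                                                           
                                                   
(** Only a pair with [k = 1] can come from the filling of a hole, so it is enough to keep holes off
    the left column. *)
Lemma cw_sub : rhombs n (cw_edge a b m) \subset P.
Proof.
have in0 t : t <= m -> rhomb n 0 (a + 1 + t) b \in P.
  by move=> tm; have [_ + _] := clo tm; rewrite /tiling_config orbF => /andP[].
have in2 t : t <= m -> rhomb n 2 (a + t) (b + 1 + m - t) \in P.
  by move=> tm; have [_ _] := clo tm; rewrite /tiling_config orbF => /andP[].
have in1' t : t <= m -> (rhomb n 1 a (b + t) \in P) || dn_hole S a (b + t).
  by move=> tm; have [+ _ _] := clo tm; rewrite /tiling_config => /andP[].
(* A hole cell here would have its upward neighbours in the hole too, but one of them is covered by
   a rhombus of [P]: the first of the bottom row if [t = 0], otherwise the vertical one just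
   below. *)
have noh t : t <= m -> dn_hole S a (b + t) = false.
  elim: t => [|t IHt] tm; case h: (dn_hole _ _ _) => //.
    have := dn_up_hole (isT : 2 < 3) h; rewrite /up_x /up_y /= !addn0 => u.
    have := rhomb_in_holed_region tilP (isT : 0 < 3) (in0 0 (leq0n m)).
    by rewrite /up_x /up_y /= !addn0 u => -[].
  have := dn_up_hole (isT : 0 < 3) h; rewrite /up_x /up_y /= !addn0 => u.
  have := in1' _ (ltnW tm); rewrite IHt ?(ltnW tm) // orbF => h1.
  have [_ _] := rhomb_in_holed_region tilP (isT : 1 < 3) h1.
  by rewrite /up_x /up_y /= addn0 addn1 -addnS u.
have in1 t : t <= m -> rhomb n 1 a (b + t) \in P.
  by move=> tm; have := in1' t tm; rewrite noh // orbF.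
apply/subsetP => _ /(in_rhombs _ (cw_range abm))[k [i [j [k3 ek ->]]]].
case: k k3 ek => [|[|[|//]]] _ /and3P[/eqP e1 e2 e3].
- have -> : i = a + 1 + (i - a.+1) by move: e2; clear; lia.
  by rewrite e1; apply: in0; move: e2 e3; clear; lia.
- have -> : j = b + (j - b) by move: e2; clear; lia.
  by rewrite e1; apply: in1; move: e2 e3; clear; lia.
have -> : j = b + 1 + m - (i - a) by move: e1 e2 e3; clear; lia.
have -> : i = a + (i - a) by move: e2; clear; lia.
by rewrite addKn; apply: in2; move: e2 e3; clear; lia.
Qed.

Lemma flip_tiling : tiling (holed_region S) Q.
Proof. exact: tiling_exchange tilP cw_sub (tiling_cw abm) (tiling_ccw abm). Qed.

Lemma flip_GD : GD_flip P Q.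
Proof.
exists a, b, m, (rhombs n (cw_edge a b m)), (rhombs n (ccw_edge a b m)).
by split=> //; [apply: CW_GD_rhombs | apply: CCW_GD_rhombs | apply: cw_sub].
Qed.

(** Otherwise it would meet, hence equal, a rhombus of the CW-GD, but the two tilings share none. *)
Lemma ccw_disjoint k i j : k < 3 -> ccw_edge a b m k i j -> rhomb n k i j \notin P.
Proof.
move=> k3 ek; apply/negP => kP.
have [_ _ cG _] := iffLR (tilingP _ _) (tiling_cw abm).
have [_ sH _ _] := iffLR (tilingP _ _) (tiling_ccw abm).
have [_ _ _ uP] := iffLR (tilingP _ _) tilP.
have kH : rhomb n k i j \in rhombs n (ccw_edge a b m).
  by rewrite rhomb_in_rhombs //; apply: ccw_range.
have [x xk] : exists x, x \in rhomb n k i j.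
  have [xn yn] := rhomb_range k3 (rhombus_rhomb k3 (ccw_range abm k3 ek)).
  by exists (true, (Ordinal xn, Ordinal yn)); rewrite in_rhomb !eqxx.
have [B BG xB] := cG x (subsetP (sH _ kH) _ xk).
have eB := uP _ _ x (subsetP cw_sub _ BG) kP xB xk.
move: BG; rewrite eB rhomb_in_rhombs //; last exact: cw_range.
by move: ek; clear -k3; case: k k3 => [|[|[|//]]] _; rewrite /cw_edge /ccw_edge; lia.
Qed.

(** In each row [j] from [b] to [b + m] a vertical rhombus moves from [a] to [a + b + m + 1 - j];
    other rows keep theirs. *)
Lemma flip_potential : potential P < potential Q.
Proof.
have rowE i j : (rhomb n 1 i j \in Q) =
    (rhomb n 1 i j \in P) && ~~ cw_edge a b m 1 i j || ccw_edge a b m 1 i j.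
  by rewrite in_setU in_setD (rhomb_in_rhombs _ _ (ccw_range abm)) //
    (rhomb_in_rhombs _ _ (cw_range abm)) // andbC.
have cwP i j : cw_edge a b m 1 i j -> rhomb n 1 i j \in P.
  by move=> e1; apply: (subsetP cw_sub); rewrite rhomb_in_rhombs //; apply: cw_range.
have lt_row (j : 'I_n) : b <= j <= b + m ->
    \sum_(i < n) (rhomb n 1 i j \in P) * i < \sum_(i < n) (rhomb n 1 i j \in Q) * i.
  move=> jin; have a_lt : a < n by move: abm; clear; lia.
  have i1_lt : a + b + m + 1 - j < n by move: abm; clear; lia.
  apply: (@row_sum_lt n (fun i => rhomb n 1 i j \in P) _ (Ordinal a_lt) (Ordinal i1_lt)).
  - by apply: cwP; move: jin; rewrite /cw_edge /=; clear; lia.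
  - by apply: ccw_disjoint => //; move: jin; rewrite /ccw_edge /=; clear; lia.
  - by move: jin; rewrite /=; clear; lia.
  move=> i; rewrite rowE -!(inj_eq val_inj) /=; congr (_ && _ || _);
  by move: jin; move: (i : nat) (j : nat) => x y; clear; lia.
have b_lt : b < n by move: abm; clear; lia.
rewrite /potential (bigD1 (Ordinal b_lt)) //= [X in _ < X](bigD1 (Ordinal b_lt)) //=.
rewrite -addSn; apply: leq_add; first by apply: (lt_row (Ordinal b_lt)); rewrite /= leqnn leq_addr.
apply: leq_sum => j _; have [jin|jin] := boolP (b <= j <= b + m).
  exact: ltnW (lt_row _ jin).
apply: leq_sum => i _; rewrite rowE leq_mul2r; apply/orP; right.
have -> : cw_edge a b m 1 i j = false by move: jin; rewrite /cw_edge; clear; lia.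
by rewrite andbT; case: (_ \in P).
Qed.

End Flip.

                     

(** * Joining two tilings through the terminal one *)

Definition flip_connected n (S : {set hole n}) (P Q : {set {set cell n}}) : Prop :=
  exists (k : nat) (c : nat -> {set {set cell n}}),
    [/\ c 0 = P, c k = Q,
        forall i, i <= k -> tiling (holed_region S) (c i)
      & forall i, i < k -> GD_flip (c i) (c i.+1) \/ GD_flip (c i.+1) (c i)].

Lemma flip_connected_sym n (S : {set hole n}) P Q :
  flip_connected S P Q -> flip_connected S Q P.
Proof.
move=> [k [c [c0 ck tc fc]]]; exists k, (fun i => c (k - i)).
rewrite subn0 subnn; split=> // i ik; first by apply: tc; apply: leq_subr.
have := fc (k - i.+1); rewrite -subSn // subSS; case; first by move: ik; clear; lia.
  by right.
by left.
Qed.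

Lemma flip_connected_cons n (S : {set hole n}) P P' Q :
  tiling (holed_region S) P -> GD_flip P P' \/ GD_flip P' P ->
  flip_connected S P' Q -> flip_connected S P Q.
Proof.
move=> tP fP [k [c [c0 ck tc fc]]]; exists k.+1, (fun i => if i is i'.+1 then c i' else P).
by split=> // -[|i] //=; [exact: tc | rewrite c0 | exact: fc].
Qed.

Lemma flip_connected_trans n (S : {set hole n}) P R Q :
  flip_connected S P R -> flip_connected S R Q -> flip_connected S P Q.
Proof.
move=> [k]; elim: k P => [|k IHk] P [c [c0 ck tc fc]] RQ.
  by rewrite -c0 ck.
apply: (flip_connected_cons (P' := c 1)).
- by rewrite -c0; apply: tc.
- by have := fc 0 isT; rewrite c0.
apply: IHk RQ; exists (fun i => c i.+1); split=> // i ik; first exact: tc.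
exact: fc.
Qed.

Definition flippable n (S : {set hole n}) (P : {set {set cell n}}) : Prop :=
  exists a b m, a + b + m + 3 <= n /\ closed_tri (tiling_config S P) a b m.

(** Induction on the gap between [potential] and its upper bound, which each flip narrows. *)
Lemma flip_to_terminal n (S : {set hole n}) P : tiling (holed_region S) P ->
  exists R, [/\ tiling (holed_region S) R, flip_connected S P R & ~ flippable S R].
Proof.
have [d] := ubnPleq (\sum_(j < n) \sum_(i < n) i - potential P); elim: d P => [|d IHd] P le_d tP.
  exists P; split=> //; first by exists 0, (fun=> P); split=> // -[].
  move=> [a [b [m [abm clo]]]]; rewrite -addnA in abm.
  have := flip_potential tP abm clo; have := @potential_le n.
  by move=> le lt; have := leq_trans lt (le _); rewrite ltnNge -subn_eq0 -leqn0 le_d.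
have [[a [b [m [abm clo]]]]|no] := classic (flippable S P); last first.
  by exists P; split=> //; exists 0, (fun=> P); split=> // -[].
rewrite -addnA in abm; have lt := flip_potential tP abm clo.
have tQ := flip_tiling tP abm clo.
have [|R [tR QR nR]] := IHd _ _ tQ.
  by move: le_d lt (leq_trans lt (potential_le _)); clear; lia.
exists R; split=> //; apply: flip_connected_cons QR => //.
by left; exact: (flip_GD tP abm clo).
Qed.

(** The configurations agree by [config_eq]; rhombi avoid the holes, so they can be read off the
    configuration without confusion with the filling. *)
Lemma terminal_uniq n (S : {set hole n}) P Q :
  tiling (holed_region S) P -> tiling (holed_region S) Q ->
  ~ flippable S P -> ~ flippable S Q -> P = Q.
Proof.
move=> tP tQ nP nQ.
have E := config_eq (tiling_configP tP) (tiling_configP tQ) nP nQ.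
have sub (A B : {set {set cell n}}) : tiling (holed_region S) A -> tiling (holed_region S) B ->
    (forall k i j, k < 3 -> tiling_config S A k i j = tiling_config S B k i j) ->
    A \subset B.
  move=> tA tB EAB; apply/subsetP => R RA.
  have [rA _ _ _] := iffLR (tilingP _ _) tA.
  have /rhombusP[k [i [j [k3 _ _ eR]]]] := rA _ RA; rewrite eR in RA *.
  have [ijn nh _] := rhomb_in_holed_region tA k3 RA.
  by have := EAB _ i j k3; rewrite /tiling_config ijn RA (negbTE nh) andbF /= orbF => <-.
by apply/eqP; rewrite eqEsubset !sub // => k i j k3; rewrite E.
Qed.

Theorem mainTheorem3 (n : nat) (n_gt0 : 0 < n) (S : {set hole n})
    (arrS : arrangement S) (P Q : {set {set cell n}})
    (tilP : tiling (holed_region S) P) (tilQ : tiling (holed_region S) Q) :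
  exists (k : nat) (c : nat -> {set {set cell n}}),
    [/\ c 0 = P, c k = Q,
        forall i, i <= k -> tiling (holed_region S) (c i)
      & forall i, i < k -> GD_flip (c i) (c i.+1) \/ GD_flip (c i.+1) (c i)].
Proof.
have [R [tR PR nR]] := flip_to_terminal tilP.
have [R' [tR' QR' nR']] := flip_to_terminal tilQ.
have eR := terminal_uniq tR tR' nR nR'; rewrite -eR in QR'.
exact: flip_connected_trans PR (flip_connected_sym QR').
Qed.
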